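(* Fix $\varepsilon\in(0,1/2)$, $\gamma\in(1/2+\varepsilon,1)$, $\delta>0$ and $\rho\in(0,1)$. For $\Delta$ large enough the following holds. Let $C_A=C_B$ be a binary linear code of length $\Delta$, rate $\rho$ and minimum distance $\delta\Delta$, such that the dual tensor code $C_A\otimes\mathbb F_2^B+\mathbb F_2^A\otimes C_B$ is $\Delta^{3/2-\varepsilon/2}$-robust with $\Delta^\gamma$-resistance to puncturing. Then there is a constant $a>0$ (independent of $n$) such that, for every left-right Cayley complex $X=X(G,A,B)$ with $|A|=|B|=\Delta$ that satisfies the Total No-Conjugacy condition and for which $\mathrm{Cay}(G,A)$ and $\mathrm{Cay}(G,B)$ are Ramanujan, the Tanner code $$\mathcal C=\{x\in\mathbb F_2^Q:\ x_v\in C_A\otimes C_B\ \text{ for all } v\in V_0\}$$ of length $n=|Q|$ is $\kappa$-locally testable with $\Delta^2$ queries, where $$\kappa=\min\Big(\frac{a}{a+1},\ \frac{\delta}{8\Delta^{3/2+\varepsilon}}\Big).$$ Explicitly, the tester that picks a uniformly random $v\in V_0$, reads the $\Delta^2$ bits of $x_v$ and accepts if and only if $x_v\in C_A\otimes C_B$ accepts every $x\in\mathcal C$, and for every $x\in\mathbb F_2^Q$ its rejection probability $\zeta(x)=|\{v\in V_0: x_v\notin C_A\otimes C_B\}|/|V_0|$ satisfies $$\zeta(x)\ \ge\ \kappa\,\frac1n\,d(x,\mathcal C),$$ where $d(x,\mathcal C)$ is the Hamming distance from $x$ to $\mathcal C$.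
   Context: **Left-right Cayley complex $X(G,A,B)$.** $G$ is a finite group and $A=A^{-1}$, $B=B^{-1}$ are subsets of $G$ with $|A|=|B|=\Delta$, satisfying the Total No-Conjugacy (TNC) condition: $ag\neq gb$ for all $a\in A$, $b\in B$, $g\in G$. Put $V_0=G\times\{0\}$, $V_1=G\times\{1\}$. The set $Q$ of squares is the set of all 4-subsets $\{(g,0),(ag,1),(gb,1),(agb,0)\}$ with $g\in G,a\in A,b\in B$; $|Q|=\Delta^2|G|/2$. For $v=(g,i)$, $Q(v)$ denotes the set of squares containing $v$. By TNC the map $(a,b)\mapsto\{(g,i),(ag,1-i),(gb,1-i),(agb,i)\}$ is a bijection $A\times B\to Q(v)$. For $x\in\mathbb F_2^Q$ the local view $x_v$ is the restriction of $x$ to $Q(v)$, viewed through this bijection as an element of $\mathbb F_2^{A\times B}$ (matrices with rows indexed by $A$, columns by $B$). **Codes.** Codes of length $\Delta$ are viewed as subspaces $C_A\subset\mathbb F_2^A$, $C_B\subset\mathbb F_2^B$ through fixed bijections of $A$ and $B$ with $\{1,\dots,\Delta\}$. $C_A\otimes C_B$ is the space of $A\times B$ matrices with all columns in $C_A$ and all rows in $C_B$; $C_A\otimes\mathbb F_2^B$ is the space of matrices with all columns in $C_A$, $\mathbb F_2^A\otimes C_B$ that of matrices with all rows in $C_B$. **Robustness.** Let $C_A,C_B$ have minimum distances $d_A,d_B$. The dual tensor code $C_A\otimes\mathbb F_2^B+\mathbb F_2^A\otimes C_B$ is $w$-robust if for every codeword $x$ in it with Hamming weight $|x|\le w$ there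 exist $A'\subset A$, $B'\subset B$ with $|A'|\le|x|/d_B$, $|B'|\le|x|/d_A$ such that $x_{ab}=0$ whenever $a\notin A'$ and $b\notin B'$. For $A'\subset A$, $C_{A'}\subset\mathbb F_2^{A'}$ is the punctured code of restrictions to $A'$ of codewords of $C_A$; similarly $C_{B'}$. The dual tensor code is $w$-robust with $p$-resistance to puncturing if for all $A'\subset A$, $B'\subset B$ with $|A'|=|B'|=\Delta-w'$, $w'\le p$, the dual tensor code $C_{A'}\otimes\mathbb F_2^{B'}+\mathbb F_2^{A'}\otimes C_{B'}$ is $w$-robust (with respect to the minimum distances of $C_{A'},C_{B'}$). **Ramanujan.** $\mathrm{Cay}(G,A)$ has edges $\{g,ag\}$, $\mathrm{Cay}(G,B)$ has edges $\{g,gb\}$. Here these are required to be connected and non-bipartite with every eigenvalue other than $\Delta$ of absolute value at most $2\sqrt{\Delta-1}$. *)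

(* Defs.v *)
From mathcomp Require Import all_boot all_order all_algebra all_fingroup.
From mathcomp Require Import reals exp.

Set Implicit Arguments.
Unset Strict Implicit.
Unset Printing Implicit Defensive.

Import Order.TTheory GRing.Theory Num.Theory.

Local Open Scope ring_scope.

Definition hweight (m n : nat) (x : 'M['F_2]_(m, n)) : nat :=
  #|[set p : 'I_m * 'I_n | x p.1 p.2 != 0]|.

(* The default n.+1 exceeds every weight, so it is the value exactly when C is
   the zero code. *)
Definition min_dist (n : nat) (C : {vspace 'rV['F_2]_n}) : nat :=
  \big[Order.min/n.+1]_(x : 'rV['F_2]_n | (x \in C) && (x != 0)) hweight x.

Definition in_tensor (m n : nat) (CA : {vspace 'rV['F_2]_m})
    (CB : {vspace 'rV['F_2]_n}) (x : 'M['F_2]_(m, n)) : bool :=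
  [forall j, (col j x)^T \in CA] && [forall i, row i x \in CB].

Definition in_dual_tensor (m n : nat) (CA : {vspace 'rV['F_2]_m})
    (CB : {vspace 'rV['F_2]_n}) (x : 'M['F_2]_(m, n)) : Prop :=
  exists y z : 'M['F_2]_(m, n),
    [/\ x = y + z, in_tensor CA fullv y & in_tensor fullv CB z].

Definition robust (R : realType) (m n : nat) (CA : {vspace 'rV['F_2]_m})
    (CB : {vspace 'rV['F_2]_n}) (w : R) : Prop :=
  forall x : 'M['F_2]_(m, n), in_dual_tensor CA CB x -> (hweight x)%:R <= w ->
  exists (A' : {set 'I_m}) (B' : {set 'I_n}),
    [/\ #|A'|%:R <= (hweight x)%:R / (min_dist CB)%:R :> R,
        #|B'|%:R <= (hweight x)%:R / (min_dist CA)%:R :> R &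
        forall i j, i \notin A' -> j \notin B' -> x i j = 0].

(* Coordinates in S are renumbered by 'I_#|S| through enum_val. *)
Definition puncture (n : nat) (C : {vspace 'rV['F_2]_n}) (S : {set 'I_n}) :
    {vspace 'rV['F_2]_#|S|} :=
  (linfun (colsub (fun k : 'I_#|S| => enum_val k)) @: C)%VS.

Definition robust_resistant (R : realType) (n : nat)
    (CA CB : {vspace 'rV['F_2]_n}) (w p : R) : Prop :=
  forall (A' B' : {set 'I_n}) (w' : nat),
    w'%:R <= p -> (#|A'| + w' = n)%N -> (#|B'| + w' = n)%N ->
    robust (puncture CA A') (puncture CB B') w.

Definition adjacency (R : realType) (T : finType) (e : rel T) : 'M[R]_#|T| :=
  \matrix_(i, j) (e (enum_val i) (enum_val j))%:R.

Definition bipartite (T : finType) (e : rel T) : Prop :=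
  exists f : T -> bool, forall x y, e x y -> f x != f y.

Definition ramanujan (R : realType) (T : finType) (e : rel T) (d : nat) : Prop :=
  [/\ forall x y, connect e x y,
      ~ bipartite e &
      forall lam : R, eigenvalue (adjacency R e) lam -> lam != d%:R ->
        `|lam| <= 2 * Num.sqrt (d%:R - 1)].

Definition cayley_left (gT : finGroupType) (A : {set gT}) : rel gT :=
  fun g h => [exists a in A, h == (a * g)%g].

Definition cayley_right (gT : finGroupType) (B : {set gT}) : rel gT :=
  fun g h => [exists b in B, h == (g * b)%g].

Definition TNC (gT : finGroupType) (A B : {set gT}) : Prop :=
  forall a b g, a \in A -> b \in B -> (a * g)%g <> (g * b)%g.

Definition lr_cayley (gT : finGroupType) (A B : {set gT}) (Delta : nat) : Prop :=
  [/\ (A^-1 = A)%g, (B^-1 = B)%g, #|A| = Delta, #|B| = Delta & TNC A B].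

(* The vertex (g, i) of V_i is encoded with i = false for 0 and i = true for 1. *)
Definition square (gT : finGroupType) (g a b : gT) : {set gT * bool} :=
  [set (g, false); ((a * g)%g, true); ((g * b)%g, true); ((a * g * b)%g, false)].

Definition squares (gT : finGroupType) (A B : {set gT}) :
    {set {set gT * bool}} :=
  [set q | [exists g, exists a in A, exists b in B, q == square g a b]].

Notation lrsquare A B := {q : {set _ * bool} | q \in squares A B}.

Definition squares_at (gT : finGroupType) (A B : {set gT}) (v : gT * bool) :
    {set lrsquare A B} :=
  [set q : lrsquare A B | v \in val q].

Lemma square_in (gT : finGroupType) (A B : {set gT}) (g : gT)
    (a : {a : gT | a \in A}) (b : {b : gT | b \in B}) :
  square g (val a) (val b) \in squares A B.
Proof.
rewrite inE; apply/existsP; exists g.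
apply/existsP; exists (val a); rewrite (valP a) /=.
by apply/existsP; exists (val b); rewrite (valP b) eqxx.
Qed.

Definition incident_square (gT : finGroupType) (A B : {set gT}) (g : gT)
    (a : {a : gT | a \in A}) (b : {b : gT | b \in B}) : lrsquare A B :=
  exist _ (square g (val a) (val b)) (square_in g a b).

(* Local view at the vertex (g, 0); eA and eB number the rows and columns. *)
Definition local_view (gT : finGroupType) (A B : {set gT}) (Delta : nat)
    (eA : 'I_Delta -> {a : gT | a \in A}) (eB : 'I_Delta -> {b : gT | b \in B})
    (x : {ffun lrsquare A B -> 'F_2}) (g : gT) : 'M['F_2]_Delta :=
  \matrix_(i, j) x (incident_square g (eA i) (eB j)).

(* The vertices (g, 0) of V_0 are indexed by g. *)
Definition tanner_code (gT : finGroupType) (A B : {set gT}) (Delta : nat)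
    (eA : 'I_Delta -> {a : gT | a \in A}) (eB : 'I_Delta -> {b : gT | b \in B})
    (C : {vspace 'rV['F_2]_Delta}) : {set {ffun lrsquare A B -> 'F_2}} :=
  [set x | [forall g, in_tensor C C (local_view eA eB x g)]].

Definition hdist (I : finType) (x y : {ffun I -> 'F_2}) : nat :=
  #|[set i | x i != y i]|.

(* All distances are at most #|I|, so the default is irrelevant for a nonempty
   code. *)
Definition hdist_code (I : finType) (x : {ffun I -> 'F_2})
    (code : {set {ffun I -> 'F_2}}) : nat :=
  \big[Order.min/#|I|]_(c in code) hdist x c.

(* The tester draws v : V uniformly, reads the coordinates in query v and then
   decides by accept v. *)
Definition rejection_prob (R : realType) (I V : finType)
    (accept : V -> {ffun I -> 'F_2} -> bool) (x : {ffun I -> 'F_2}) : R :=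
  #|[set v | ~~ accept v x]|%:R / #|V|%:R.

Definition local_tester (R : realType) (I V : finType)
    (code : {set {ffun I -> 'F_2}}) (query : V -> {set I})
    (accept : V -> {ffun I -> 'F_2} -> bool) (q : nat) (kappa : R) : Prop :=
  [/\ forall v, #|query v| = q,
      forall v (x y : {ffun I -> 'F_2}), {in query v, x =1 y} -> accept v x = accept v y,
      forall x, x \in code -> forall v, accept v x &
      forall x, rejection_prob R accept x
                  >= kappa * (1 / #|I|%:R) * (hdist_code x code)%:R].

(* Main.v *)
Require Import Defs.
From mathcomp Require Import all_boot all_order all_algebra all_fingroup.
From mathcomp Require Import reals exp.
From mathcomp Require Import sesquilinear spectral complex.
From mathcomp Require Import zify ring lra.

Set Implicit Arguments.
Unset Strict Implicit.
Unset Printing Implicit Defensive.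

Import Order.TTheory GRing.Theory Num.Theory.

Local Open Scope ring_scope.

(** Decode by local descent. Replace every local view that passes the test by
    itself and every other one by 0, and let Z be the mismatch: at each square,
    the sum of the two values proposed by its vertices in V_0. At most Delta^2
    squares per rejecting vertex are mismatched, and at each vertex of V_1 the
    view of Z lies in the dual tensor code. If Z is non-zero and its support is a
    sufficiently small fraction (depending on Delta) of the squares, then
    expansion and robustness, as in the distance proof of quantum Tanner codes,
    yield a vertex of V_0 at which adding a tensor codeword makes Z lighter:
    - most V_1-vertices touched by Z are normal (light view), and by robustness
      each of those has a heavy row or column;
    - by expansion these heavy lines concentrate on few vertices of V_0, so one
      of them has linearly many heavy lines and few abnormal neighbours;
    - after puncturing the abnormal lines, its view is close to a column
      codeword matrix and to a row codeword matrix, hence, by robustness of the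
      punctured code, close to a tensor codeword.
    Iterating reaches Z = 0, that is, a codeword of the Tanner code, after at most
    |Z| changes. If Z is not small, there are already many rejecting vertices.
    As the constant a may depend on Delta, every bound can be crude in Delta. *)

(** * Spectral gap of Ramanujan graphs *)

Lemma sqnorm_mx (C : numClosedFieldType) n (v : 'rV[C]_n) :
  (v *m (v ^t* )%sesqui) 0 0 = \sum_j `|v 0 j| ^+ 2.
Proof.
by rewrite mxE; apply: eq_bigr => j _; rewrite !mxE normCK.
Qed.

(** Over the complex numbers a real symmetric matrix is unitarily diagonalisable; the unitary
    factors preserve the sum of squares and each diagonal entry scales by at most [lam]. *)
Lemma symmetric_norm_bound (R : rcfType) n (M : 'M[R]_n) (lam : R) :
  M^T = M -> (forall mu, eigenvalue M mu -> `|mu| <= lam) ->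
  forall f : 'rV_n,
    \sum_j (f *m M) 0 j ^+ 2 <= lam ^+ 2 * \sum_j f 0 j ^+ 2.
Proof.
move=> Msym Mlam f.
pose N := map_mx (real_complex R) M.
have toC_real (x : R) : x%:C%C \is Num.real by rewrite complex_real.
have Nherm : N \is hermsymmx.
  apply: realsym_hermsym; last by apply/mxOverP => i j; rewrite mxE toC_real.
  rewrite is_hermitianmxE expr0 scale1r map_mx_id //.
  by rewrite /N map_trmx Msym.
have /hermitian_normalmx /orthomx_spectralP := Nherm.
set P := spectralmx N; set d := spectral_diag N => NE.
have PU : P \is unitarymx by exact: spectral_unitarymx.
(* The diagonal entries are real because [N] is hermitian, and they are roots of a characteristic
   polynomial with coefficients in [R], so they are eigenvalues of [M] itself. *)
have Nd (k : 'I_n) : `|d 0 k| <= lam%:C%C.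
  have /mxOverP/(_ 0 k) d_real := hermitian_spectral_diag_real Nherm.
  have [mu dE] : exists mu, d 0 k = mu%:C%C.
    by exists (complex.Re (d 0 k)); exact: (esym (RRe_real d_real)).
  rewrite dE normc_def /= expr0n /= addr0 sqrtr_sqr lecR; apply: Mlam.
  rewrite eigenvalue_root_char -(fmorph_root (real_complex R)) map_char_poly.
  change (root (char_poly N) (mu%:C%C)); rewrite -eigenvalue_root_char.
  apply/eigenvalueP; exists (row k P).
    rewrite -row_mul NE !mulmxA mulmxV ?unitarymx_unit // mul1mx -dE.
    by rewrite row_mul row_diag_mx -scalemxAl -rowE.
  apply/eqP => /(congr1 (mulmx^~ (invmx P))).
  rewrite -row_mul mulmxV ?unitarymx_unit // mul0mx => /rowP /(_ k).
  by rewrite !mxE eqxx => /eqP; rewrite oner_eq0.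
pose w := map_mx (real_complex R) f *m (P ^t* )%sesqui.
have fNE : map_mx (real_complex R) (f *m M) = w *m diag_mx d *m P.
  by rewrite map_mxM /= -/N NE invmx_unitary // !mulmxA.
have PPt : P *m (P ^t* )%sesqui = 1%:M by apply/unitarymxP.
have PtP : (P ^t* )%sesqui *m P = 1%:M.
  by rewrite -invmx_unitary // mulVmx ?unitarymx_unit.
have normU (v : 'rV_n) : \sum_j `|(v *m P) 0 j| ^+ 2 = \sum_j `|v 0 j| ^+ 2.
  by rewrite -!sqnorm_mx trmx_mul map_mxM mulmxA -(mulmxA v) PPt mulmx1.
have sqC (v : 'rV[R]_n) :
    \sum_j `|map_mx (real_complex R) v 0 j| ^+ 2 = (\sum_j v 0 j ^+ 2)%:C%C.
  rewrite (rmorph_sum (real_complex R)); apply: eq_bigr => j _.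
  by rewrite mxE real_normK // -(rmorphXn (real_complex R)).
have fE : map_mx (real_complex R) f = w *m P by rewrite -mulmxA PtP mulmx1.
rewrite -lecR -[X in X <= _]sqC [X in _ <= X](rmorphM (real_complex R)).
rewrite -[X in _ * X]sqC.
rewrite fNE fE !normU mulr_sumr; apply: ler_sum => j _.
rewrite mul_mx_diag mxE normrM exprMn mulrC ler_wpM2r ?exprn_ge0 //.
by rewrite (rmorphXn (real_complex R)) lerXn2r ?nnegrE // (le_trans _ (Nd j)).
Qed.

(** Maximum principle: where [u] is maximal it is the average of its values at the neighbours, so
    these are maximal too, and connectedness spreads this. It makes the eigenvalue [k] simple. *)
Lemma harmonic_constant (R : realType) (T : finType) (e : rel T) (k : nat)
    (al : 'I_k -> T -> T) (u : T -> R) :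
  (forall x y, e x y = [exists i, y == al i x]) ->
  (forall x y, connect e x y) ->
  (forall x, \sum_i u (al i x) = k%:R * u x) ->
  forall x y, u x = u y.
Proof.
move=> eE econn uharm.
suff uc (x : T) : exists m, forall y, u y = m.
  by move=> x y; have [m um] := uc x; rewrite !um.
pose x0 := [arg max_(y > x) u y]%O.
have umax y : u y <= u x0 by rewrite /x0; case: arg_maxP => // i _; apply.
have step y w : e y w -> u y = u x0 -> u w = u x0.
  rewrite eE => /existsP[i /eqP->] uy.
  have /eqP : \sum_i (u x0 - u (al i y)) = 0.
    by rewrite sumrB uharm sumr_const card_ord uy mulr_natl subrr.
  rewrite psumr_eq0; last by move=> j _; rewrite subr_ge0.
  by move=> /allP /(_ i (mem_index_enum _)); rewrite subr_eq0 => /eqP <-.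
exists (u x0) => y; have /connectP[p pth ->] := econn x0 y.
suff path_max v : path e v p -> u v = u x0 -> u (last v p) = u x0.
  exact: path_max.
elim: p v {pth} => //= w p IHp v /andP[evw pth] uv.
exact: IHp pth (step _ _ evw uv).
Qed.

(** The eigenvalue [k] belongs to the constants alone, so on mean-zero functions only the other
    eigenvalues act; [4 * k] rounds up the square of [2 * sqrt (k - 1)]. *)
Lemma ramanujan_gap (R : realType) (T : finType) (e : rel T) (k : nat)
    (al : 'I_k -> T -> T) :
  (0 < k)%N ->
  (forall x y, e x y = [exists i, y == al i x]) -> symmetric e ->
  (forall x, injective (al^~ x)) ->
  ramanujan R e k ->
  forall f : T -> R, \sum_x f x = 0 ->
    \sum_x (\sum_i f (al i x)) ^+ 2 <= 4 * k%:R * \sum_x f x ^+ 2.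
Proof.
move=> k_gt0 eE esym al_inj [econn _ eig] f f0.
have reenum (F : T -> R) : \sum_x F x = \sum_(i < #|T|) F (enum_val i).
  exact: (reindex _ (onW_bij _ (enum_val_bij T))).
(* Distinct generators give distinct neighbours, so the 0/1 adjacency matrix counts each translation
   exactly once. *)
have sum_e (F : T -> R) y : \sum_x F x * (e x y)%:R = \sum_i F (al i y).
  under eq_bigr => x _ do rewrite esym mulr_natr mulrb.
  rewrite -big_mkcond /=.
  rewrite (eq_bigl (mem [set al i y | i in 'I_k])); last first.
    move=> x /=; rewrite eE; apply/existsP/imsetP => [[i /eqP->]|[i _ ->]].
      by exists i.
    by exists i.
  by rewrite big_imset //= => i j _ _; apply: al_inj.
pose n : R := #|T|%:R.
have [T0|T_gt0] := posnP #|T|.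
  by rewrite !reenum !big1 ?mulr0 // => -[i ilt]; exfalso; rewrite T0 in ilt.
have n0 : n != 0 by rewrite pnatr_eq0 -lt0n.
(* Subtracting the projection onto constants removes the eigenvalue k. *)
pose M := adjacency R e - const_mx (k%:R / n).
have Msym : M^T = M by apply/matrixP => i j; rewrite !mxE esym.
have mulM (v : 'rV[R]_#|T|) j : (v *m M) 0 j =
    \sum_i v 0 (enum_rank (al i (enum_val j))) - k%:R / n * \sum_i v 0 i.
  rewrite mxE; under eq_bigr => i _ do rewrite !mxE mulrBr.
  rewrite sumrB -mulr_suml [_ * (k%:R / n)]mulrC; congr (_ - _).
  rewrite -(sum_e (fun y => v 0 (enum_rank y))) reenum; apply: eq_bigr => i _.
  by rewrite enum_valK.
have norm1 : \sum_(i < #|T|) k%:R / n = k%:R.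
  by rewrite sumr_const card_ord -[LHS]mulr_natr divfK.
have Mlam mu : eigenvalue M mu -> `|mu| <= 2 * Num.sqrt (k%:R - 1).
  case/eigenvalueP => v vM v_neq0.
  have [->|mu_neq0] := eqVneq mu 0.
    by rewrite normr0 mulr_ge0 ?sqrtr_ge0.
  (* The entries of [v *m M] sum to zero for every [v], so an eigenvector with [mu != 0] has mean
     zero. *)
  have v_sum : \sum_i v 0 i = 0.
    have : \sum_j (v *m M) 0 j = 0.
      under eq_bigr => j _ do rewrite mulM.
      rewrite sumrB -mulr_suml norm1.
      rewrite -(reenum (fun y => \sum_i v 0 (enum_rank (al i y)))).
      under eq_bigr => y _ do rewrite -(sum_e (fun z => v 0 (enum_rank z))).
      rewrite exchange_big /=.
      have -> : \sum_(j : T) \sum_(i : T) v 0 (enum_rank j) * (e j i)%:R =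
                \sum_(j : T) v 0 (enum_rank j) * k%:R.
        apply: eq_bigr => j _; rewrite -mulr_sumr; congr (_ * _).
        under eq_bigr => i _ do rewrite esym -[_%:R]mul1r.
        by rewrite (sum_e (fun=> 1)) sumr_const card_ord.
      rewrite -mulr_suml reenum.
      rewrite (eq_bigr (v 0)) => [|i _]; last by rewrite enum_valK.
      by rewrite mulrC subrr.
    rewrite vM; under eq_bigr => j _ do rewrite mxE.
    by rewrite -mulr_sumr => /eqP; rewrite mulf_eq0 (negPf mu_neq0) => /eqP.
  have vadj j : \sum_i v 0 (enum_rank (al i j)) = mu * v 0 (enum_rank j).
    move/rowP/(_ (enum_rank j)): vM; rewrite mulM v_sum mulr0 subr0 enum_rankK.
    by rewrite mxE.
  apply: eig.
    apply/eigenvalueP; exists v => //; apply/rowP => j.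
    rewrite !mxE -[j in RHS]enum_valK -vadj.
    rewrite -(sum_e (fun y => v 0 (enum_rank y))) reenum.
    by apply: eq_bigr => i _; rewrite !mxE enum_valK.
  (* If [mu] were [k], the eigenvector would be harmonic, hence constant, hence zero because its
     entries sum to zero. *)
  apply: contraNneq v_neq0 => mu_k.
  have vc := harmonic_constant (u := fun y => v 0 (enum_rank y)) eE econn _.
  have {}vc i j : v 0 i = v 0 j.
    rewrite -(enum_valK i) -(enum_valK j); apply: vc => x.
    by rewrite vadj mu_k.
  apply/eqP/rowP => j; rewrite mxE.
  move: v_sum; rewrite (eq_bigr (fun=> v 0 j)) // sumr_const card_ord.
  by move/eqP; rewrite -[X in X == 0]mulr_natr mulf_eq0 (negPf n0) orbF => /eqP.
pose g : 'rV[R]_#|T| := \row_j f (enum_val j).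
have := symmetric_norm_bound Msym Mlam g.
rewrite exprMn sqr_sqrtr ?subr_ge0 ?ler1n //.
have -> : \sum_(j < #|T|) g 0 j ^+ 2 = \sum_x f x ^+ 2.
  by rewrite reenum; apply: eq_bigr => j _; rewrite mxE.
have -> : \sum_(j < #|T|) (g *m M) 0 j ^+ 2 =
          \sum_x (\sum_i f (al i x)) ^+ 2.
  rewrite reenum; apply: eq_bigr => j _; congr (_ ^+ 2); rewrite mulM.
  have -> : \sum_i g 0 i = 0.
    by rewrite -[RHS]f0 reenum; apply: eq_bigr => i _; rewrite mxE.
  rewrite mulr0 subr0; apply: eq_bigr => i _.
  by rewrite mxE enum_rankK.
move/le_trans; apply; rewrite ler_wpM2r ?sumr_ge0 // => [x _|]; first exact: sqr_ge0.
by rewrite -natrX ler_wpM2l ?ler0n // gerBl.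
Qed.

(** * Expander mixing *)

(** [K] bounds the square of an operator norm on mean-zero functions. *)
Definition spectral_gap (R : realType) (V I : finType) (al : I -> V -> V)
    (K : R) : Prop :=
  forall f : V -> R, \sum_x f x = 0 ->
    \sum_x (\sum_i f (al i x)) ^+ 2 <= K * \sum_x f x ^+ 2.

(** Each [al i] is a permutation, so averaging along [al] keeps the mean zero and the two gaps can
    be applied in turn. This handles the graph whose edges are the diagonals of the squares. *)
Lemma spectral_gap_comp (R : realType) (V I J : finType) (al : I -> V -> V)
    (be : J -> V -> V) (K L : R) :
  0 <= L -> (forall i, injective (al i)) ->
  spectral_gap al K -> spectral_gap be L ->
  spectral_gap (fun ij : I * J => al ij.1 \o be ij.2) (L * K).
Proof.
move=> L_ge0 al_inj gapA gapB f f0.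
have := gapB (fun x => \sum_i f (al i x)); rewrite exchange_big /=.
have -> : \sum_(i : I) \sum_x f (al i x) = 0.
  by rewrite big1 // => i _; rewrite -[RHS]f0 [RHS](reindex_inj (al_inj i)).
move=> /(_ erefl) le1; have le2 := ler_wpM2l L_ge0 (gapA f f0).
rewrite -mulrA (le_trans _ le2) // (le_trans _ le1) //.
apply: ler_sum => x _; rewrite exchange_big /=.
by rewrite (pair_big xpredT xpredT (fun i j => f (al i (be j x)))).
Qed.

(** Cauchy-Schwarz against the indicator of [S], obtained by expanding the squares of
    [s * h x - H]. *)
Lemma sum_sqr_le (R : realType) (V : finType) (S : {set V}) (h : V -> R) :
  (\sum_(x in S) h x) ^+ 2 <= #|S|%:R * \sum_x h x ^+ 2.
Proof.
set H := \sum_(x in S) h x; set s : R := #|S|%:R.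
have [S0|S_gt0] := posnP #|S|.
  have -> : H = 0 by rewrite /H (cards0_eq S0) big_set0.
  by rewrite expr0n mulr_ge0 ?ler0n ?sumr_ge0 // => x _; exact: sqr_ge0.
have s_gt0 : 0 < s by rewrite ltr0n.
have le1 : \sum_(x in S) h x ^+ 2 <= \sum_x h x ^+ 2.
  by rewrite [leRHS](bigID (mem S)) /= lerDl sumr_ge0 // => x _; exact: sqr_ge0.
apply: le_trans (ler_wpM2l (ltW s_gt0) le1).
have : 0 <= \sum_(x in S) (s * h x - H) ^+ 2.
  by apply: sumr_ge0 => x _; exact: sqr_ge0.
rewrite (eq_bigr (fun x => s ^+ 2 * h x ^+ 2 - 2 * s * H * h x + H ^+ 2));
  last by move=> x _; ring.
rewrite big_split sumrB /= sumr_const -!mulr_sumr -/H -[_ *+ _]mulr_natr -/s.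
set q := \sum_(x in S) h x ^+ 2 => le2.
rewrite -subr_ge0 -(pmulr_rge0 _ s_gt0); apply: le_trans le2 _.
by rewrite le_eqVlt; apply/orP; left; apply/eqP; ring.
Qed.

Lemma sum_mem_card (V : finType) (P : pred V) :
  (\sum_x P x)%N = #|[set x | P x]|.
Proof.
by rewrite -sum1dep_card [RHS]big_mkcond /=; apply: eq_bigr => x _; case: (P x).
Qed.

(** The deviation of the edge count from its expected value is the sum over [S] of the operator
    applied to the centred indicator [f] of [T]; Cauchy-Schwarz and the gap bound it. *)
Lemma mixing (R : realType) (V I : finType) (al : I -> V -> V) (K : R)
    (S T : {set V}) :
  0 <= K -> spectral_gap al K ->
  (\sum_(x in S) #|[set i | al i x \in T]|%:R
     - #|I|%:R * #|S|%:R * #|T|%:R / #|V|%:R) ^+ 2 <= K * (#|S|%:R * #|T|%:R).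
Proof.
move=> K_ge0 gap; set n : R := #|V|%:R; set t : R := #|T|%:R.
have [V0|V_gt0] := posnP #|V|.
  have -> : S = set0 by apply/setP => x; have := fintype0 x V0.
  by rewrite big_set0 cards0 !mulr0 !mul0r subrr expr0n mulr0.
have n_gt0 : 0 < n by rewrite ltr0n.
pose f x : R := (x \in T)%:R - t / n.
have sumT : \sum_x (x \in T)%:R = t.
  rewrite -natr_sum; congr (_%:R); rewrite sum_mem_card.
  by apply: eq_card => x; rewrite inE.
have f0 : \sum_x f x = 0.
  by rewrite sumrB sumT sumr_const -[X in _ - X]mulr_natr divfK ?subrr ?gt_eqF.
have f2 : \sum_x f x ^+ 2 <= t.
  have -> : \sum_x f x ^+ 2 = \sum_x ((x \in T)%:R - t / n * (2 * f x + t / n)).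
    apply: eq_bigr => x _; rewrite /f.
    by move: (t / n) => c; case: (x \in T) => /=; ring.
  rewrite sumrB sumT -mulr_sumr big_split /= -mulr_sumr f0 mulr0 add0r.
  rewrite gerBl mulr_ge0 ?divr_ge0 ?ler0n // sumr_ge0 // => x _.
  by rewrite divr_ge0 ?ler0n.
have -> : \sum_(x in S) #|[set i | al i x \in T]|%:R
     - #|I|%:R * #|S|%:R * t / n = \sum_(x in S) \sum_i f (al i x).
  under [RHS]eq_bigr => x _ do rewrite sumrB sumr_const.
  rewrite sumrB sumr_const; congr (_ - _).
    apply: eq_bigr => x _; rewrite -natr_sum; congr (_%:R).
    by rewrite sum_mem_card.
  by rewrite -[RHS]mulr_natr -[X in _ = X * _]mulr_natr; ring.
apply: le_trans (sum_sqr_le _ _) _.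
rewrite mulrCA ler_wpM2l ?ler0n // (le_trans (gap _ f0)) // ler_wpM2l //.
Qed.

(** * Tensor codes and robustness *)

Lemma min_dist_le_hweight n (C : {vspace 'rV['F_2]_n}) (u : 'rV_n) :
  u \in C -> u != 0 -> (min_dist C <= hweight u)%N.
Proof. by move=> uC u0; rewrite -leEnat; apply: bigmin_le_cond; rewrite uC. Qed.

Lemma min_dist_leS n (C : {vspace 'rV['F_2]_n}) : (min_dist C <= n.+1)%N.
Proof. by rewrite -leEnat; apply: bigmin_le_id. Qed.

Lemma le_min_dist n (C : {vspace 'rV['F_2]_n}) m :
  (m <= n.+1)%N -> (forall u : 'rV_n, u \in C -> u != 0 -> (m <= hweight u)%N) ->
  (m <= min_dist C)%N.
Proof.
move=> mn mC; rewrite -leEnat; apply/le_bigmin; first by rewrite leEnat.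
by move=> u /andP[uC u0]; apply: mC.
Qed.

Lemma hweight_row n (u : 'rV['F_2]_n) : hweight u = #|[set j | u 0 j != 0]|.
Proof.
rewrite /hweight -[RHS](card_imset _ (f := fun j => (0 : 'I_1, j)));
  last by move=> ? ? [].
apply: eq_card => -[i j]; rewrite ord1 !inE /=.
by apply/idP/imsetP => [uj|[k]]; [exists j; rewrite ?inE | rewrite inE => uk [->]].
Qed.

Lemma code_eq0 n (C : {vspace 'rV['F_2]_n}) (S : {set 'I_n}) (u : 'rV_n) :
  u \in C -> (#|S| < min_dist C)%N -> (forall j, j \notin S -> u 0 j = 0) -> u = 0.
Proof.
move=> uC Sd uS; apply/eqP; apply: contraTT Sd => u0; rewrite -leqNgt.
apply: leq_trans (min_dist_le_hweight uC u0) _; rewrite hweight_row.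
apply: subset_leq_card; apply/subsetP => j; rewrite inE; apply: contraNT => jS.
by rewrite uS.
Qed.

Definition mask n (S : {set 'I_n}) : 'M['F_2]_n :=
  diag_mx (\row_j (j \in S)%:R).

Lemma mul_maskE m n (S : {set 'I_n}) (x : 'M['F_2]_(m, n)) i j :
  (x *m mask S) i j = if j \in S then x i j else 0.
Proof. by rewrite mul_mx_diag !mxE; case: (j \in S); rewrite ?mulr1 ?mulr0. Qed.

(** Fewer than [min_dist C] erasures can be corrected linearly: restriction to [S] is injective on
    [C], so it has a left inverse on [C]. The decoder [P] lands in [C] on every input, which is what
    makes decoded matrices have their lines in [C]. *)
Lemma erasure_decoder n (C : {vspace 'rV['F_2]_n}) (S : {set 'I_n}) :
  (#|~: S| < min_dist C)%N ->
  exists P : 'M['F_2]_n,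
    (forall v : 'rV_n, v *m P \in C) /\
    forall u : 'rV_n, u \in C -> u *m mask S *m P = u.
Proof.
move=> Sd; pose M := \matrix_(i < \dim C) (vbasis C)`_i.
have MC (v : 'rV_(\dim C)) : v *m M = \sum_i v 0 i *: (vbasis C)`_i.
  by rewrite mulmx_sum_row; apply: eq_bigr => i _; rewrite rowK.
have MinC (v : 'rV_(\dim C)) : v *m M \in C.
  by rewrite MC memv_suml // => i _; rewrite memvZ // vbasis_mem ?mem_nth ?size_tuple.
have Mfree : row_free (M *m mask S).
  rewrite -kermx_eq0; apply/rowV0P => v /sub_kermxP; rewrite mulmxA => vMS.
  have /eqP vM0 : v *m M == 0.
    apply/eqP; apply: (code_eq0 (MinC v) Sd) => j; rewrite inE negbK => jS.
    by move/rowP/(_ j): vMS; rewrite mul_maskE jS => ->; rewrite mxE.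
  have /freeP vfree := basis_free (vbasisP C).
  by apply/rowP => i; rewrite mxE; apply: vfree i; rewrite -MC.
exists (pinvmx (M *m mask S) *m M); split=> [v|u uC]; first by rewrite mulmxA.
have [v ->] : exists v, u = v *m M.
  exists (\row_i coord (vbasis C) i u); rewrite MC [LHS](coord_vbasis uC).
  by apply: eq_bigr => i _; rewrite mxE.
by rewrite -(mulmxA v M) -(mulmxA v) (mulmxA _ (pinvmx _)) mulmxVp ?mul1mx.
Qed.

(** Decoding columns from the rows in [A] and rows from the columns in [B] are left and right
    multiplications, so they commute. As [y] and [z] agree on [A] times [B], one matrix [x] arises
    both by decoding the rows of [y] and by decoding the columns of [z]. *)
Lemma tensor_extension n (C : {vspace 'rV['F_2]_n}) (y z : 'M['F_2]_n)
    (A B : {set 'I_n}) :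
  (#|~: A| < min_dist C)%N -> (#|~: B| < min_dist C)%N ->
  (forall j, (col j y)^T \in C) -> (forall i, row i z \in C) ->
  (forall i j, i \in A -> j \in B -> y i j = z i j) ->
  exists x, [/\ in_tensor C C x, forall i j, j \in B -> x i j = y i j &
                forall i j, i \in A -> x i j = z i j].
Proof.
move=> Ad Bd yC zC yz.
have [P [PC decP]] := erasure_decoder Ad; have [Q [QC decQ]] := erasure_decoder Bd.
have yP : (y^T *m mask A *m P)^T = y.
  apply: (canLR (@trmxK _ _ _)); apply/row_matrixP => j.
  by rewrite !row_mul -tr_col decP.
have zQ : z *m mask B *m Q = z by apply/row_matrixP => i; rewrite !row_mul decQ.
have yzmask : (y^T *m mask A)^T *m mask B = (z^T *m mask A)^T *m mask B.
  apply/matrixP => i j; rewrite !mul_maskE; case: ifP => // jB.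
  rewrite [LHS]mxE [RHS]mxE !mul_maskE; case: ifP => // iA.
  by rewrite !mxE yz.
have xE : y *m mask B *m Q = (z^T *m mask A *m P)^T.
rewrite -{1}yP trmx_mul -(mulmxA _ _ (mask B)) yzmask !trmx_mul !trmxK.
  by rewrite -!mulmxA (mulmxA z) zQ.
exists (y *m mask B *m Q); split=> [|i j jB|i j iA].
- apply/andP; split; apply/forallP => k; last by rewrite row_mul.
  by rewrite xE tr_col trmxK row_mul.
- rewrite xE -[in RHS]yP ![X in X = _]mxE ![X in _ = X]mxE.
  apply: eq_bigr => k _; rewrite !mul_maskE !mxE; case: ifP => // kA.
  by rewrite yz.
- rewrite -[in RHS]zQ !mxE; apply: eq_bigr => k _; rewrite !mul_maskE.
  by case: ifP => // kB; rewrite yz.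
Qed.

Lemma min_dist_puncture n (C : {vspace 'rV['F_2]_n}) (S : {set 'I_n}) :
  (min_dist C - #|~: S| <= min_dist (puncture C S))%N.
Proof.
apply: le_min_dist => [|v /memv_imgP[u uC ->]].
  (* The default value of [min_dist] for the zero code respects the bound as well. *)
  rewrite leq_subLR addnS addnC cardsC card_ord; exact: min_dist_leS.
rewrite lfunE /= => v0; rewrite leq_subLR.
have u0 : u != 0 by apply: contraNneq v0 => ->; rewrite linear0.
apply: leq_trans (min_dist_le_hweight uC u0) _; rewrite !hweight_row.
rewrite -[X in (_ <= _ + X)%N](card_imset _ (@enum_val_inj _ (mem S))).
apply: leq_trans (leq_card_setU _ _); apply: subset_leq_card.
apply/subsetP => j; rewrite !inE => uj; case: (boolP (j \in S)) => //= jS.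
apply/imsetP; exists (enum_rank_in jS j); last by rewrite enum_rankK_in.
by rewrite inE mxE enum_rankK_in.
Qed.

(** Robustness of the punctured code in the original coordinates, with products in place of
    quotients; deleting [k] coordinates leaves a distance of at least [min_dist C - k]. *)
Lemma robust_resistant_sum (R : realType) n (C : {vspace 'rV['F_2]_n}) (w p : R)
    (A B : {set 'I_n}) (k : nat) (y z : 'M['F_2]_n) :
  robust_resistant C C w p -> k%:R <= p ->
  #|~: A| = k -> #|~: B| = k -> (k < min_dist C)%N ->
  (forall j, (col j y)^T \in C) -> (forall i, row i z \in C) ->
  let N := #|[set ij in setX A B | (y + z) ij.1 ij.2 != 0]| in
  N%:R <= w ->
  exists A1 B1 : {set 'I_n},
    [/\ (#|A1| * (min_dist C - k) <= N)%N, (#|B1| * (min_dist C - k) <= N)%N &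
        forall i j, i \in A :\: A1 -> j \in B :\: B1 -> (y + z) i j = 0].
Proof.
move=> rob kp Ak Bk kd yC zC N Nw.
pose f := @enum_val _ (mem A); pose g := @enum_val _ (mem B).
pose x := mxsub f g (y + z).
have x_dual : in_dual_tensor (puncture C A) (puncture C B) x.
  exists (mxsub f g y), (mxsub f g z); split.
  - by apply/matrixP => i j; rewrite !mxE.
  - apply/andP; split; apply/forallP => j; last by rewrite memvf.
    have -> : (col j (mxsub f g y))^T = linfun (colsub f) (col (g j) y)^T.
      by rewrite lfunE; apply/rowP => i; rewrite !mxE.
    by rewrite memv_img.
  - apply/andP; split; apply/forallP => i; first by rewrite memvf.
    have -> : row i (mxsub f g z) = linfun (colsub g) (row (f i) z).
      by rewrite lfunE; apply/rowP => j; rewrite !mxE.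
    by rewrite memv_img.
have x_le : (hweight x <= N)%N.
  pose fg (ij : 'I_#|A| * 'I_#|B|) := (f ij.1, g ij.2).
  rewrite /hweight -(card_imset _ (f := fg)); last first.
    by move=> [i j] [i' j'] [/enum_val_inj-> /enum_val_inj->].
  apply: subset_leq_card; apply/subsetP => q /imsetP[[i j]].
  move=> xij ->; rewrite !inE /= /f /g !enum_valP /=.
  by move: xij; rewrite inE !mxE.
have An : (#|A| + k = n)%N by rewrite -Ak cardsC card_ord.
have Bn : (#|B| + k = n)%N by rewrite -Bk cardsC card_ord.
have [|A1 [B1 [A1le B1le x0]]] := rob A B k kp An Bn x x_dual.
  by apply: le_trans Nw; rewrite ler_nat.
have count (S : {set 'I_n}) m : #|~: S| = k ->
    m%:R <= (hweight x)%:R / (min_dist (puncture C S))%:R :> R ->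
    (m * (min_dist C - k) <= N)%N.
  move=> Sk; have := min_dist_puncture C S; rewrite Sk => dle.
  rewrite ler_pdivlMr; last by rewrite ltr0n (leq_trans _ dle) // subn_gt0.
  rewrite -natrM ler_nat => mle; apply: leq_trans x_le.
  by apply: leq_trans mle; rewrite leq_mul2l dle orbT.
exists (f @: A1), (g @: B1); split=> [||i j].
- by rewrite card_imset; [exact: count A1le | exact: enum_val_inj].
- by rewrite card_imset; [exact: count B1le | exact: enum_val_inj].
rewrite !inE => /andP[iA1 iA] /andP[jB1 jB].
have := x0 (enum_rank_in iA i) (enum_rank_in jB j).
rewrite mxE /f /g !enum_rankK_in //; apply.
  apply: contra iA1 => iA1; apply/imsetP; exists (enum_rank_in iA i) => //.
  by rewrite /f enum_rankK_in.
apply: contra jB1 => jB1; apply/imsetP; exists (enum_rank_in jB j) => //.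
by rewrite /g enum_rankK_in.
Qed.

Definition row_supp n (x : 'M['F_2]_n) (i : 'I_n) : {set 'I_n} :=
  [set j | x i j != 0].

Lemma hweight_sum_rows n (x : 'M['F_2]_n) :
  hweight x = (\sum_i #|row_supp x i|)%N.
Proof.
rewrite (eq_bigr (fun i => (\sum_(j | x i j != 0%R) 1)%N)) => [|i _].
  by rewrite pair_big_dep /= /hweight -sum1_card; apply: eq_bigl => p; rewrite inE.
by rewrite -sum1_card; apply: eq_bigl => j; rewrite inE.
Qed.

Lemma hweight_tr n (x : 'M['F_2]_n) : hweight x^T = hweight x.
Proof.
rewrite /hweight -[RHS](card_imset _ (f := fun p => (p.2, p.1)));
  last by move=> [? ?] [? ?] [-> ->].
apply: eq_card => -[i j]; rewrite inE mxE /=.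
apply/idP/imsetP => [xji|[[k l]]]; first by exists (j, i); rewrite ?inE.
by rewrite inE /= => xkl [-> ->].
Qed.

Lemma hweight_gt0 m n (x : 'M['F_2]_(m, n)) : x != 0 -> (0 < hweight x)%N.
Proof.
move=> x0; rewrite lt0n cards_eq0; apply: contraNneq x0 => x0.
apply/eqP/matrixP => i j; rewrite mxE; apply/eqP; apply: contraT => xij.
by have := in_set0 (i, j); rewrite -x0 inE xij.
Qed.

(** Robustness makes [y] and [- z] agree off the few rows [A1] and columns [B1]. They extend to a
    common tensor codeword [x], and moving [x] from [y] to [z] leaves summands supported on the
    columns [B1] and the rows [A1]. The bound by the squared distance makes both sets small enough
    to decode. *)
Lemma dual_tensor_decomposition (R : realType) n (C : {vspace 'rV['F_2]_n})
    (w p : R) (W y z : 'M['F_2]_n) :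
  robust_resistant C C w p -> 0 <= p -> (hweight W)%:R <= w ->
  (hweight W < min_dist C * min_dist C)%N ->
  W = y + z -> (forall j, (col j y)^T \in C) -> (forall i, row i z \in C) ->
  exists (y1 z1 : 'M['F_2]_n) (A1 B1 : {set 'I_n}),
    [/\ W = y1 + z1, forall j, (col j y1)^T \in C & forall i, row i z1 \in C] /\
    [/\ (#|A1| * min_dist C <= hweight W)%N, (#|B1| * min_dist C <= hweight W)%N,
        forall i j, j \notin B1 -> y1 i j = 0 &
        forall i j, i \notin A1 -> z1 i j = 0].
Proof.
move=> rob p_ge0 Ww Wd WE yC zC.
have d_gt0 : (0 < min_dist C)%N by case: (min_dist C) Wd.
have C0 : #|~: [set: 'I_n]| = 0%N by rewrite setCT cards0.
have NE : #|[set ij in setX [set: 'I_n] [set: 'I_n] | (y + z) ij.1 ij.2 != 0]|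
            = hweight W.
  by rewrite WE; apply: eq_card => ij; rewrite !inE.
have := robust_resistant_sum (k := 0) rob p_ge0 C0 C0 d_gt0 yC zC.
rewrite /= NE subn0 => /(_ Ww) [A1 [B1 [A1d B1d yz0]]].
have A1C : (#|~: ~: A1| < min_dist C)%N.
  by rewrite setCK -(ltn_pmul2r d_gt0) (leq_ltn_trans A1d).
have B1C : (#|~: ~: B1| < min_dist C)%N.
  by rewrite setCK -(ltn_pmul2r d_gt0) (leq_ltn_trans B1d).
have zNC i : row i (- z) \in C by rewrite linearN /= memvN.
have [i j|x [xC xy xz]] := tensor_extension A1C B1C yC zNC.
  rewrite !inE => iA jB; apply/eqP; rewrite mxE -addr_eq0.
  have := yz0 i j; rewrite !inE iA jB mxE => -> //.
case/andP: xC => /forallP xcol /forallP xrow.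
exists (y - x), (z + x), A1, B1; split; split => //.
- by rewrite WE addrACA addNr addr0.
- by move=> j; rewrite !linearB rpredB ?xcol ?yC.
- by move=> i; rewrite linearD rpredD ?xrow ?zC.
- by move=> i j jB; rewrite !mxE xy ?subrr // inE.
- by move=> i j iA; rewrite !mxE xz ?inE // mxE subrr.
Qed.

(** A row of [W] can differ from the codeword in [z] only on [B]. A non-zero row of [z] has weight
    at least [min_dist C], of which [y] cancels at most #|B| entries. *)
Lemma row_close n (C : {vspace 'rV['F_2]_n}) (W y z : 'M['F_2]_n)
    (B : {set 'I_n}) :
  W = y + z -> (forall i, row i z \in C) -> (forall i j, j \notin B -> y i j = 0) ->
  (forall i, exists2 v, v \in C & (#|[set j | W i j != v 0%R j]| <= #|B|)%N) /\
  (z != 0 -> exists i, (min_dist C <= #|row_supp W i| + #|B|)%N).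
Proof.
move=> -> zC yB; split=> [i|z0].
  exists (row i z) => //; apply: subset_leq_card; apply/subsetP => j.
  rewrite inE !mxE; apply: contraNT => jB; by rewrite yB // add0r.
have [i zi0] : exists i, row i z != 0.
  apply/existsP; apply: contraNT z0; rewrite negb_exists => /forallP z0.
  by apply/eqP/row_matrixP => i; rewrite row0; have /negbNE/eqP := z0 i.
exists i; apply: leq_trans (min_dist_le_hweight (zC i) zi0) _.
rewrite hweight_row; apply: leq_trans (leq_card_setU _ _).
apply: subset_leq_card; apply/subsetP => j; rewrite !inE !mxE => zij.
by case: (boolP (j \in B)) => [|jB]; rewrite ?orbT // yB // add0r zij.
Qed.

(** The weight bound leaves at most [m] exceptional rows and columns in the decomposition. If
    [W != 0], one summand is non-zero and yields a line of weight at least [min_dist C - m], hence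
    at least half the distance. *)
Lemma dual_tensor_lines (R : realType) n (C : {vspace 'rV['F_2]_n})
    (w p : R) (W y z : 'M['F_2]_n) (m : nat) :
  robust_resistant C C w p -> 0 <= p -> (hweight W)%:R <= w ->
  (0 < min_dist C)%N -> (hweight W < m.+1 * min_dist C)%N -> (2 * m <= min_dist C)%N ->
  W = y + z -> (forall j, (col j y)^T \in C) -> (forall i, row i z \in C) ->
  [/\ forall i, exists2 v, v \in C & (#|[set j | W i j != v 0%R j]| <= m)%N,
      forall j, exists2 v, v \in C & (#|[set i | W i j != v 0%R i]| <= m)%N &
      W != 0 -> (exists i, (min_dist C <= 2 * #|row_supp W i|)%N) \/
                (exists j, (min_dist C <= 2 * #|row_supp W^T j|)%N)].
Proof.
move=> rob p_ge0 Ww d_gt0 Wm md WE yC zC.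
have Wd : (hweight W < min_dist C * min_dist C)%N.
  apply: leq_trans Wm _; rewrite leq_pmul2r //; lia.
have [y1 [z1 [A1 [B1 [[W1 y1C z1C] [A1d B1d y1B z1A]]]]]] :=
  dual_tensor_decomposition rob p_ge0 Ww Wd WE yC zC.
have A1m : (#|A1| <= m)%N by rewrite -ltnS -(ltn_pmul2r d_gt0) (leq_ltn_trans A1d).
have B1m : (#|B1| <= m)%N by rewrite -ltnS -(ltn_pmul2r d_gt0) (leq_ltn_trans B1d).
have [rows hrow] := row_close W1 z1C y1B.
have WT : W^T = z1^T + y1^T by rewrite W1 linearD addrC.
have yT i : row i y1^T \in C by rewrite -tr_col.
have [|cols hcol] := row_close WT yT (B := A1).
  by move=> i j jA; rewrite mxE z1A.
split=> [i|j|W0].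
- by have [v vC le] := rows i; exists v => //; apply: leq_trans le _.
- have [v vC le] := cols j; exists v => //; apply: leq_trans A1m.
  by apply: leq_trans le; apply: eq_leq; apply: eq_card => i; rewrite !inE mxE.
have [z0|z0] := eqVneq z1 0; last by left; have [i le] := hrow z0; exists i; lia.
right; have [|j le] := hcol; last by exists j; lia.
apply: contraNneq W0 => y0; rewrite W1 z0 addr0.
by rewrite -(trmxK y1) y0 trmx0.
Qed.

(** When the expected degree into [T] is at most [a / 2], vertices of [S] exceed it by at least
    [a / 2], and mixing bounds the square of this total excess. *)
Lemma mixing_dense (R : realType) (V I : finType) (al : I -> V -> V) (K a : R)
    (S T : {set V}) :
  0 <= K -> spectral_gap al K -> 0 <= a ->
  (forall x, x \in S -> a <= #|[set i | al i x \in T]|%:R) ->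
  #|I|%:R * #|T|%:R / #|V|%:R <= a / 2 ->
  a ^+ 2 * #|S|%:R <= 4 * K * #|T|%:R.
Proof.
move=> K_ge0 gap a_ge0 dense small.
have := mixing S T K_ge0 gap.
set E := \sum_(x in S) _; set s : R := #|S|%:R; set t : R := #|T|%:R.
have s_ge0 : 0 <= s by rewrite ler0n.
have t_ge0 : 0 <= t by rewrite ler0n.
have Ea : a * s <= E.
  rewrite mulr_natr -sumr_const; apply: ler_sum => x xS; exact: dense.
have -> : #|I|%:R * s * t / #|V|%:R = s * (#|I|%:R * t / #|V|%:R) by ring.
have := ler_wpM2l s_ge0 small; rewrite -/t.
set M := s * (#|I|%:R * t / #|V|%:R) => Ms EM.
have half : 0 <= a * s / 2 <= E - M by apply/andP; split; [nra | lra].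
have {}EM : (a * s / 2) ^+ 2 <= K * (s * t).
  apply: le_trans EM; case/andP: half => h1 h2.
  by rewrite lerXn2r // nnegrE //; lra.
have [s0|s_neq0] := eqVneq s 0; first by rewrite s0 mulr0 !mulr_ge0.
have s_gt0 : 0 < s by rewrite lt_def s_neq0.
rewrite -(ler_pM2r s_gt0); nra.
Qed.

(** * The local improvement step *)

(** The square with indices [(i, j)] at the V_1-vertex [x] passes through the V_0-vertex [al i x],
    where its indices are [(s i, j)]. *)
Definition other_view (V : finType) n (al : 'I_n -> V -> V) (s : 'I_n -> 'I_n)
    (Z : V -> 'M['F_2]_n) (x : V) : 'M['F_2]_n :=
  \matrix_(i, j) Z (al i x) (s i) j.

(* [Z x] is the view of a word on the squares at the vertex [x] of V_0 and
   [other_view al s Z x] its view at the vertex [x] of V_1; [al] and [be] are the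
   translations by the generators, [s] and [t] invert the generators. Swapping
   the two sides and transposing is a symmetry, which halves the argument. *)
Record square_views n (C : {vspace 'rV['F_2]_n}) (V : finType)
    (al be : 'I_n -> V -> V) (s t : 'I_n -> 'I_n) (Z : V -> 'M['F_2]_n) : Prop :=
  SquareViews {
    sv_sK : involutive s;
    sv_tK : involutive t;
    sv_alK : forall i x, al (s i) (al i x) = x;
    sv_beK : forall j x, be (t j) (be j x) = x;
    sv_comm : forall i j x, al i (be j x) = be j (al i x);
    sv_sym : forall x i j, Z (al i (be j x)) (s i) (t j) = Z x i j;
    sv_dual : forall x, exists y z,
      [/\ other_view al s Z x = y + z, forall j, (col j y)^T \in C &
          forall i, row i z \in C] }.

Lemma other_view_tr n (C : {vspace 'rV['F_2]_n}) (V : finType)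
    (al be : 'I_n -> V -> V) s t Z x :
  square_views C al be s t Z ->
  other_view be t (fun y => (Z y)^T) x = (other_view al s Z x)^T.
Proof.
case=> sK tK alK beK comm sym _; apply/matrixP => i j; rewrite !mxE.
by rewrite -(sym (al j x)) sK comm alK.
Qed.

Lemma square_views_tr n (C : {vspace 'rV['F_2]_n}) (V : finType)
    (al be : 'I_n -> V -> V) s t Z :
  square_views C al be s t Z ->
  square_views C be al t s (fun x => (Z x)^T).
Proof.
move=> sv; have [sK tK alK beK comm sym dual] := sv.
split=> // [x i j|x]; first by rewrite !mxE -comm sym.
have [y [z [Wyz yC zC]]] := dual x; exists z^T, y^T; split=> [|j|i].
- by rewrite (other_view_tr x sv) Wyz linearD addrC.
- by rewrite tr_col trmxK.
- by rewrite -tr_col.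
Qed.

(** Resistance to puncturing deletes equally many rows and columns, so the exceptional sets must be
    padded to a common size. *)
Lemma subset_card_exact (T : finType) (A : {set T}) k :
  (#|A| <= k <= #|T|)%N -> exists2 B : {set T}, A \subset B & #|B| = k.
Proof.
case/andP=> Ak kT; have [m mE] : exists m, k = (#|A| + m)%N.
  by exists (k - #|A|)%N; rewrite subnKC.
subst k; clear Ak; elim: m kT => [|m IHm] kT.
  by exists A => //; rewrite addn0.
have [|B AB Bm] := IHm; first by lia.
have /subsetPn[x _ xB] : ~~ ([set: T] \subset B).
  by apply: contraTN kT => /subset_leq_card; rewrite cardsT Bm; lia.
exists (x |: B); first by rewrite (subset_trans AB) ?subsetUr.
by rewrite cardsU1 xB Bm; lia.
Qed.

Lemma card_pairs_le (I J : finType) (Q : I -> J -> bool) m :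
  (forall i, #|[set j | Q i j]| <= m)%N -> (#|[set ij | Q ij.1 ij.2]| <= #|I| * m)%N.
Proof.
move=> Qm; rewrite -sum1_card (eq_bigl (fun ij => Q ij.1 ij.2)); last first.
  by move=> ij; rewrite inE.
rewrite -(pair_big_dep xpredT Q (fun _ _ => 1%N)) /= -sum_nat_const.
by apply: leq_sum => i _; rewrite sum1dep_card.
Qed.

Section LocalImprovement.

(* In the application u = Delta^(1/2-eps), p = Delta^gamma and
   r = Delta^(3/2-eps/2); a normal view lives on at most v rows and v columns. *)

Variables (R : realType) (D : nat) (C : {vspace 'rV['F_2]_D}).
Local Notation n := (D%:R : R).
Variables (delta u v p r : R).
Hypotheses (D_gt0 : (0 < D)%N) (delta_gt0 : 0 < delta) (delta_le2 : delta <= 2).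
Hypotheses (dE : (min_dist C)%:R = delta * n) (uE : u = v * delta).
Hypotheses (u_ge12 : 12 <= u) (p_ge1 : 1 <= p) (up : 128 * n <= u * p).
Hypotheses (ur : 2 * n * u <= delta * r).
Hypothesis v_small : p + 4 * (v / delta) + v < delta ^+ 3 * n / 2048.
Hypothesis rob : robust_resistant C C r p.

Let n_ge1 : 1 <= n. Proof. by rewrite ler1n. Qed.

Let d_gt0 : (0 < min_dist C)%N.
Proof. by rewrite -(ltr0n R) dE mulr_gt0 ?ltr0n. Qed.

Let v_ge6 : 6 <= v.
Proof.
rewrite -(ler_pM2r delta_gt0) -uE.
by have := u_ge12; have := delta_le2; lra.
Qed.

Let vd_ge : v <= 2 * (v / delta).
Proof.
rewrite mulrA ler_pdivlMr // [_ * v]mulrC ler_wpM2l //.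
by have := v_ge6; lra.
Qed.

Let dn_gt0 : 0 < delta * n. Proof. by rewrite mulr_gt0 ?ltr0n. Qed.

Let cube_le : delta ^+ 3 * n <= 4 * (delta * n).
Proof.
have sq : delta ^+ 2 <= 4.
  rewrite (_ : 4 = 2 ^+ 2); last by ring.
  by rewrite lerXn2r ?nnegrE // ltW.
by rewrite (exprSr _ 2) -mulrA ler_wpM2r // ltW.
Qed.

Let p_small : p + 4 * (v / delta) < delta * n / 512.
Proof. by have := v_ge6; have := v_small; have := cube_le; lra. Qed.

Let v_lin : v < delta * n / 1024.
Proof. by have := vd_ge; have := p_small; have := p_ge1; lra. Qed.

(** Since [n * u] equals [v * min_dist C], a view of weight at most [n * u] is lighter than
    [m.+1 * min_dist C], as [dual_tensor_lines] requires. *)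
Let m := Num.truncn v.
Let m_le : m%:R <= v. Proof. by rewrite truncn_le //; have := v_ge6; lra. Qed.
Let m_gt : v < m.+1%:R. Proof. exact: truncnS_gt. Qed.

Let m_half : (2 * m <= min_dist C)%N.
Proof.
rewrite -(ler_nat R) natrM dE; have := m_le; have := v_lin; have := v_ge6.
lra.
Qed.

Let nu_ge0 : 0 <= n * u.
Proof. by rewrite mulr_ge0 //; have := u_ge12; lra. Qed.

Let light_lines W : (hweight W)%:R <= n * u ->
  (exists y z, [/\ W = y + z, forall j, (col j y)^T \in C & forall i, row i z \in C]) ->
  [/\ forall i, exists2 c, c \in C & (#|[set j | W i j != c 0%R j]| <= m)%N,
      forall j, exists2 c, c \in C & (#|[set i | W i j != c 0%R i]| <= m)%N &
      W != 0 -> (exists i, (min_dist C <= 2 * #|row_supp W i|)%N) \/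
                (exists j, (min_dist C <= 2 * #|row_supp W^T j|)%N)].
Proof.
move=> Wu [y [z [Wyz yC zC]]].
apply: (dual_tensor_lines rob _ _ d_gt0 _ m_half Wyz yC zC).
- by have := p_ge1; lra.
- apply: le_trans Wu _; rewrite -(ler_pM2l delta_gt0); apply: le_trans ur.
  by rewrite -mulrA ler_wpM2r ?nu_ge0.
- rewrite -(ltr_nat R) natrM dE; apply: le_lt_trans Wu _.
  by rewrite uE mulrCA [n * _]mulrC ltr_pM2r ?m_gt.
Qed.

Section RowStep.

Variables (V : finType) (al be : 'I_D -> V -> V) (s t : 'I_D -> 'I_D).
Variable (Z : V -> 'M['F_2]_D).
Hypothesis sv : square_views C al be s t Z.
Hypotheses (gapA : spectral_gap al (4 * n)) (gapB : spectral_gap be (4 * n)).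

Let W := other_view al s Z.
Let S := [set x | W x != 0].
(* The exceptional vertices of V_1; those of S :\: Se are the normal ones. *)
Let Se := [set x | n * u < (hweight (W x))%:R].

Hypothesis S_small : 8 * n * #|S|%:R <= delta * #|V|%:R.
Hypothesis S_neq0 : S != set0.

Let V_gt0 : (0 : R) < #|V|%:R.
Proof. by rewrite ltr0n; case/set0Pn: S_neq0 => x _; apply/card_gt0P; exists x. Qed.

Let n4_ge0 : 0 <= 4 * n. Proof. by have := n_ge1; lra. Qed.

Let Z_W x i j : Z x i j = W (al i x) (s i) j.
Proof. by case: sv => sK _ alK _ _ _ _; rewrite mxE alK sK. Qed.

Let Z_W' x i j : Z x i j = W (be j x) i (t j).
Proof. by case: sv => sK _ alK _ _ sym _; rewrite mxE sym. Qed.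

Let SeS : Se \subset S.
Proof.
apply/subsetP => x; rewrite !inE; apply: contraTneq => ->.
rewrite /hweight (_ : [set _ | _] = set0) ?cards0 -?leNgt.
  by rewrite mulr_ge0 //; have := u_ge12; lra.
by apply/setP => ij; rewrite !inE mxE eqxx.
Qed.

(** A square has two opposite vertices in V_1, and both see its value. *)
Let W_nbr x i j : W x i j != 0 -> al i (be j x) \in S.
Proof.
case: sv => sK tK alK beK comm sym _ Wij; rewrite inE.
apply: contraNneq Wij => W0; rewrite mxE.
have -> : Z (al i x) (s i) j = W (al i (be j x)) (s i) (t j).
  by rewrite comm -Z_W' .
by rewrite W0 mxE.
Qed.

(* Mixing in the graph on V_1 whose edges are the squares. *)
Let card_Se : u ^+ 2 * #|Se|%:R <= 64 * #|S|%:R.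
Proof.
case: (sv) => sK tK alK beK comm sym _.
have al_inj i : injective (al i) by apply: can_inj (alK i).
have gap2 := spectral_gap_comp n4_ge0 al_inj gapA gapB.
have K_ge0 : 0 <= 4 * n * (4 * n) by apply: mulr_ge0.
have := mixing_dense (S := Se) (T := S) K_ge0 gap2 nu_ge0.
have dense x : x \in Se ->
    n * u <= #|[set ij | (al ij.1 \o be ij.2) x \in S]|%:R.
  rewrite inE => /ltW /le_trans; apply; rewrite ler_nat; apply: subset_leq_card.
  by apply/subsetP => ij; rewrite !inE /= => /W_nbr; rewrite inE.
move=> /(_ dense); rewrite card_prod !card_ord natrM.
have : n * n * #|S|%:R / #|V|%:R <= n * u / 2.
  have h : 8 * (n * #|S|%:R) <= 2 * #|V|%:R.
    by rewrite mulrA (le_trans S_small) // ler_wpM2r // ltW.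
  have h' := ler_wpM2l (ltW V_gt0) u_ge12.
  rewrite ler_pdivrMr // -!mulrA ler_wpM2l ?ler0n //.
  move: h h' V_gt0; move: (D%:R * _) (#|V|%:R) => a b h h1 h2. nra.
move=> smallS /(_ smallS); rewrite exprMn.
have n2_gt0 : 0 < n ^+ 2 by rewrite exprn_gt0 ?ltr0n.
by move=> h; rewrite -(ler_pM2l n2_gt0); nra.
Qed.

(** From [12 <= u] it follows that [u ^+ 2 / 64] exceeds 2. *)
Let card_Se_half : 2 * #|Se|%:R <= #|S|%:R :> R.
Proof.
apply: le_trans (_ : u ^+ 2 / 64 * #|Se|%:R <= _); last first.
  by rewrite mulrAC ler_pdivrMr // [leRHS]mulrC card_Se.
rewrite ler_wpM2r // ler_pdivlMr // (le_trans _ (_ : 12 ^+ 2 <= _)) //.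
  by rewrite -!natrM -natrX ler_nat.
by rewrite lerXn2r ?nnegrE //; have := u_ge12; lra.
Qed.

Let normal_lines x : x \notin Se ->
  [/\ forall i, exists2 c, c \in C & (#|[set j | W x i j != c 0%R j]| <= m)%N,
      forall j, exists2 c, c \in C & (#|[set i | W x i j != c 0%R i]| <= m)%N &
      W x != 0 -> (exists i, (min_dist C <= 2 * #|row_supp (W x) i|)%N) \/
                (exists j, (min_dist C <= 2 * #|row_supp (W x)^T j|)%N)].
Proof. by rewrite inE -leNgt => h; exact: light_lines h (sv_dual sv x). Qed.

(** Row [i] at the V_0-vertex [x] is row [s i] at its V_1-neighbour [al i x], so heavy rows of
    normal vertices can be counted from V_0. *)
Let heavy (x : V) (i : 'I_D) : bool :=
  (al i x \in S :\: Se) && (min_dist C <= 2 * #|row_supp (Z x) i|)%N.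
Let T := [set x | [exists i, heavy x i]].
Let k x := #|[set i | heavy x i]|.

(** A heavy row at [x] gives at least [delta * n / 2] neighbours in [S] under [be], so expansion of
    [be] makes such vertices few. *)
Let card_T : (delta * n) ^+ 2 * #|T|%:R <= 64 * n * #|S|%:R.
Proof.
have dn_ge0 : 0 <= delta * n / 2 by have := dn_gt0; lra.
have := mixing_dense (S := T) (T := S) n4_ge0 gapB dn_ge0.
have dense x : x \in T -> delta * n / 2 <= #|[set j | be j x \in S]|%:R.
  rewrite inE => /existsP[i /andP[_ hv]].
  have : (#|row_supp (Z x) i| <= #|[set j | be j x \in S]|)%N.
    apply: subset_leq_card; apply/subsetP => j; rewrite !inE Z_W'.
    by apply: contraNneq => ->; rewrite mxE.
  by move: hv; rewrite -!(ler_nat R) natrM dE; lra.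
move=> /(_ dense); rewrite card_ord.
have : n * #|S|%:R / #|V|%:R <= delta * n / 2 / 2.
  rewrite ler_pdivrMr //; have := n_ge1; have := V_gt0; have := S_small => h1 h2 h3.
  have h4 : 0 <= delta * #|V|%:R by apply: mulr_ge0; apply: ltW.
  have : delta * #|V|%:R <= (delta * #|V|%:R) * n by nra.
  nra.
move=> sm /(_ sm); lra.
Qed.

Let bad (ga : 'I_D -> V -> V) :=
  [set x | p < #|[set i | ga i x \in Se]|%:R].

(** Mixing gives [p ^+ 2 * #|bad ga| <= 16 * n * #|Se|]; with [card_Se] and [128 * n <= u * p] the
    factor becomes 1024 / 128^2 = 1/16. *)
Let card_bad ga : spectral_gap ga (4 * n) -> n * #|bad ga|%:R <= #|S|%:R / 16.
Proof.
move=> gap; have p_ge0 : 0 <= p by have := p_ge1; lra.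
have := mixing_dense (S := bad ga) (T := Se) n4_ge0 gap p_ge0.
have dense x : x \in bad ga -> p <= #|[set i | ga i x \in Se]|%:R.
  by rewrite inE => /ltW.
move=> /(_ dense); rewrite card_ord.
have sm : n * #|Se|%:R / #|V|%:R <= p / 2.
  rewrite ler_pdivrMr //.
  have le1 : n * #|Se|%:R <= n * #|S|%:R.
    by rewrite ler_wpM2l // ler_nat subset_leq_card.
  have le2 : 8 * (n * #|S|%:R) <= 2 * #|V|%:R.
    by rewrite mulrA (le_trans S_small) // ler_wpM2r // ltW.
  have le3 : 1 * #|V|%:R <= p * #|V|%:R by rewrite ler_wpM2r // ltW.
  by move: le1 le2 le3 V_gt0; rewrite mul1r mulrAC => *; lra.
move=> /(_ sm) le1.
have le2 := ler_wpM2l (sqr_ge0 u) le1.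
have le3 := ler_wpM2l n4_ge0 card_Se.
have le4 : (128 * n) ^+ 2 * #|bad ga|%:R <= (u * p) ^+ 2 * #|bad ga|%:R.
  rewrite ler_wpM2r // lerXn2r ?nnegrE ?mulr_ge0 //.
  by have := u_ge12; lra.
have n_gt0 : 0 < n by rewrite ltr0n.
rewrite -(ler_pM2l n_gt0).
move: le2 le3 le4; rewrite !exprMn.
move: (#|bad ga|%:R) (#|Se|%:R) (#|S|%:R) => b e c; lra.
Qed.

(* Half of the normal vertices have a heavy row; otherwise half of them have a
   heavy column, which is the transposed situation. *)
Hypothesis rows_heavy :
  (#|S :\: Se| <= 2 * #|[set x in S :\: Se |
     [exists i, min_dist C <= 2 * #|row_supp (W x) i|]]|)%N.

Let row_supp_Z x i : row_supp (Z x) i = row_supp (W (al i x)) (s i).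
Proof. by apply/setP => j; rewrite !inE Z_W. Qed.

(** Normal vertices are at least half of [S], at least half of them have a heavy row, and each such
    row is a heavy pair [(al i x, s i)] from which the vertex can be recovered. *)
Let sum_k : #|S|%:R <= 4 * \sum_(x in T) (k x)%:R :> R.
Proof.
have := rows_heavy; set N1 := [set x in S :\: Se | _] => N1S.
have N1k : (#|N1| <= \sum_(x in T) k x)%N.
  pose H := [set xi : V * 'I_D | heavy xi.1 xi.2].
  apply: (@leq_trans #|H|).
    apply: leq_trans (leq_imset_card (fun xi : V * 'I_D => al xi.2 xi.1) _).
    apply: subset_leq_card; apply/subsetP => x.
    rewrite inE => /andP[xN /existsP[i hi]].
    have [sK _ alK _ _ _ _] := sv.
    apply/imsetP; exists (al i x, s i); last by rewrite /= alK.
    by rewrite inE /heavy /= row_supp_Z alK sK xN.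
  rewrite -sum1_card (eq_bigl (fun xi => heavy xi.1 xi.2)); last first.
    by move=> xi; rewrite inE.
  rewrite -(pair_big_dep xpredT (fun x i => heavy x i) (fun _ _ => 1%N)) /=.
  rewrite (bigID (mem T)) /= [X in (_ + X)%N]big1 ?addn0.
    by apply: leq_sum => x _; rewrite sum1dep_card.
  move=> x; rewrite inE negb_exists => /forallP nh.
  by rewrite big1 // => i hi; have := nh i; rewrite hi.
have := leq_trans N1S (leq_mul (leqnn 2) N1k).
rewrite -(ler_nat R) natrM natr_sum => le1.
have := card_Se_half; have := cardsDS SeS => cD.
have : (#|S| = #|S :\: Se| + #|Se|)%N by rewrite cD subnK // subset_leq_card.
by move=> /(congr1 (fun q => q%:R : R)); rewrite natrD => -> ; lra.
Qed.

(** Averaging: otherwise vertices of [T] outside both bad sets have fewer than [ka] heavy rows and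
    the others at most [n]. The three contributions are at most #|S| / 16 each, short of the #|S| /
    4 forced by [sum_k]. *)
Let good_vertex : exists x,
  [/\ delta ^+ 2 * n / 1024 <= (k x)%:R, #|[set i | al i x \in Se]|%:R <= p &
      #|[set j | be j x \in Se]|%:R <= p].
Proof.
pose ka := delta ^+ 2 * n / 1024.
have [/existsP[x /and3P[]]|] := boolP [exists x,
    [&& ka <= (k x)%:R, #|[set i | al i x \in Se]|%:R <= p &
        #|[set j | be j x \in Se]|%:R <= p]].
  by exists x.
rewrite negb_exists => /forallP none; exfalso.
have S_gt0 : (0 : R) < #|S|%:R by rewrite ltr0n card_gt0.
have ka_ge0 : 0 <= ka.
  by apply: divr_ge0 => //; apply: mulr_ge0 => //; exact: sqr_ge0.
have kle x : x \in T ->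
    (k x)%:R <= ka + n * (x \in bad al)%:R + n * (x \in bad be)%:R.
  move=> _; have := none x; rewrite !negb_and -!ltNge.
  have kn : (k x)%:R <= n by rewrite ler_nat -[leqRHS](card_ord D) max_card.
  rewrite ![x \in bad _]inE.
  have := ler0n R D; move: (k x)%:R n kn ka_ge0 => q N qN ka0 N0.
  by case: (p < _); case: (p < _); rewrite ?orbT ?orbF /= => h; lra.
have : \sum_(x in T) (k x)%:R <=
    \sum_(x in T) (ka + n * (x \in bad al)%:R + n * (x \in bad be)%:R).
  exact: ler_sum.
rewrite !big_split /= sumr_const -!mulr_sumr.
have sum_bad ga : \sum_(x in T) (x \in bad ga)%:R <= #|bad ga|%:R :> R.
  rewrite -natr_sum ler_nat -sum1_card [leqRHS]big_mkcond /= big_mkcond /=.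
  by apply: leq_sum => x _; case: (x \in T); case: (x \in bad ga).
have le1 := ler_wpM2l (ler0n R D) (sum_bad al).
have le2 := ler_wpM2l (ler0n R D) (sum_bad be).
have le3 := card_bad gapA; have le4 := card_bad gapB.
have le5 : ka * #|T|%:R <= #|S|%:R / 16.
  have n_gt0 : 0 < n by rewrite ltr0n.
  rewrite -(ler_pM2l n_gt0) /ka; have := card_T; rewrite exprMn.
  by move: (#|T|%:R) (#|S|%:R) => a b; lra.
have := sum_k; rewrite -[ka *+ _]mulr_natr.
move: le1 le2 le3 le4 le5 S_gt0.
move: (\sum_(x in T) (k x)%:R) (#|S|%:R) (ka * _).
move: (n * #|bad al|%:R) (n * #|bad be|%:R) => a1 a2.
move: (n * _) (n * _) => a3 a4 *; lra.
Qed.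

(** At a good vertex the nearby row codewords form [z1] and the nearby column codewords [y1].
    Punctured robustness makes them agree on a large rectangle, which extends to a tensor codeword
    [y]; the error left is below the weight guaranteed by the heavy rows. *)
Lemma row_improvement :
  exists x y, in_tensor C C y /\ (hweight (Z x - y) < hweight (Z x))%N.
Proof.
have [x [kx Ap Bp]] := good_vertex; exists x.
set A0 := [set i | al i x \in Se] in Ap; set B0 := [set j | be j x \in Se] in Bp.
pose k' := maxn #|A0| #|B0|.
have k'p : k'%:R <= p by rewrite /k' /maxn; case: ifP.
have k'D : (k' <= #|'I_D|)%N by rewrite geq_max !max_card.
have [|A1 A01 A1k] := subset_card_exact (A := A0) (k := k').
  by rewrite k'D andbT; exact: leq_maxl.
have [|B1 B01 B1k] := subset_card_exact (A := B0) (k := k').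
  by rewrite k'D andbT; exact: leq_maxr.
(* Exceptional rows receive the codeword 0, only to make the choice total; likewise for columns
   below. *)
have rowsP i : exists c, c \in C /\
    (i \notin A0 -> #|[set j | Z x i j != c 0%R j]| <= m)%N.
  have [iA|iA] := boolP (i \in A0); first by exists 0; rewrite mem0v.
  have /normal_lines [rows _ _] : al i x \notin Se by move: iA; rewrite inE.
  have [c cC cm] := rows (s i); exists c; split=> // _; apply: leq_trans cm.
  by apply: eq_leq; apply: eq_card => j; rewrite !inE Z_W.
have colsP j : exists c, c \in C /\
    (j \notin B0 -> #|[set i | Z x i j != c 0%R i]| <= m)%N.
  have [jB|jB] := boolP (j \in B0); first by exists 0; rewrite mem0v.
  have /normal_lines [_ cols _] : be j x \notin Se by move: jB; rewrite inE.
  have [c cC cm] := cols (t j); exists c; split=> // _; apply: leq_trans cm.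
  by apply: eq_leq; apply: eq_card => i; rewrite !inE Z_W'.
have [f fP] := fin_all_exists rowsP; have [g gP] := fin_all_exists colsP.
pose z1 : 'M['F_2]_D := \matrix_(i, j) f i 0 j.
pose y1 : 'M['F_2]_D := \matrix_(i, j) g j 0 i.
have z1C i : row i z1 \in C.
  have -> : row i z1 = f i by apply/rowP => j; rewrite !mxE.
  by have [] := fP i.
have y1C j : (col j y1)^T \in C.
  have -> : (col j y1)^T = g j by apply/rowP => i; rewrite !mxE.
  by have [] := gP j.
have nz1C i : row i (- z1) \in C by rewrite linearN rpredN z1C.
pose E := [set ij in setX (~: A1) (~: B1) | (y1 + - z1) ij.1 ij.2 != 0].
(* Where [y1] and [z1] differ, at least one of them differs from [Z x]; each does so at most [m]
   times per non-exceptional line. *)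
have E_le : (#|E| <= 2 * (D * m))%N.
  pose E1 := [set ij : 'I_D * 'I_D | (ij.1 \notin A0) && (Z x ij.1 ij.2 != z1 ij.1 ij.2)].
  pose E2 := [set ji : 'I_D * 'I_D | (ji.1 \notin B0) && (Z x ji.2 ji.1 != y1 ji.2 ji.1)].
  have E1m : (#|E1| <= D * m)%N.
    rewrite -[in leqRHS](card_ord D).
    apply: (card_pairs_le (Q := fun i j => (i \notin A0) && (Z x i j != z1 i j))).
    move=> i; have [iA|iA] := boolP (i \in A0).
      by rewrite (_ : [set _ | _] = set0) ?cards0 //; apply/setP => j; rewrite !inE.
    have [_ /(_ iA)] := fP i; apply: leq_trans.
    by apply: eq_leq; apply: eq_card => j; rewrite !inE mxE.
  have E2m : (#|E2| <= D * m)%N.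
    rewrite -[in leqRHS](card_ord D).
    apply: (card_pairs_le (Q := fun j i => (j \notin B0) && (Z x i j != y1 i j))).
    move=> j; have [jB|jB] := boolP (j \in B0).
      by rewrite (_ : [set _ | _] = set0) ?cards0 //; apply/setP => i; rewrite !inE.
    have [_ /(_ jB)] := gP j; apply: leq_trans.
    by apply: eq_leq; apply: eq_card => i; rewrite !inE mxE.
  rewrite mul2n -addnn; apply: leq_trans (leq_add E1m E2m).
  rewrite -(card_imset E2 (f := fun ji => (ji.2, ji.1))); last first.
    by move=> [? ?] [? ?] [-> ->].
  apply: leq_trans (leq_card_setU _ _); apply: subset_leq_card.
  apply/subsetP => -[i j]; rewrite inE in_setX => /andP[/andP[]] /=.
  rewrite !in_setC => iA1 jB1 yz.
  have iA0 : i \notin A0 by apply: contra iA1; apply: (subsetP A01).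
  have jB0 : j \notin B0 by apply: contra jB1; apply: (subsetP B01).
  rewrite in_setU in_set /= iA0 /=; case: eqVneq => //= Zz.
  apply/imsetP; exists (j, i) => //; rewrite in_set /= jB0 /=.
  apply: contraNneq yz => Zy.
  by rewrite mxE [X in _ + X]mxE -Zy -Zz subrr.
have pd : p <= delta * n / 2.
  have := p_small; have := v_ge6; have := dn_gt0; have := vd_ge.
  by move: (v / delta) (delta * n) => *; lra.
have k'd : (k' < min_dist C)%N.
  by rewrite -(ltr_nat R) dE; have := dn_gt0; move: (delta * n) pd k'p => *; lra.
have E_r : #|E|%:R <= r.
  rewrite -(ler_pM2l delta_gt0); apply: le_trans ur.
  have := ler_wpM2l (ler0n R D) m_le; rewrite uE => le1.
  have : #|E|%:R <= 2 * (n * m%:R) :> R by rewrite -!natrM ler_nat.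
  move=> /(ler_wpM2l (ltW delta_gt0)) /le_trans; apply.
  rewrite (_ : 2 * n * (v * delta) = delta * (2 * (n * v))); last by ring.
  apply: ler_wpM2l; first exact: ltW.
  by rewrite ler_wpM2l.
have A1C : #|~: ~: A1| = k' by rewrite setCK.
have B1C : #|~: ~: B1| = k' by rewrite setCK.
have [A2 [B2 [A2E B2E yz0]]] :=
  robust_resistant_sum rob k'p A1C B1C k'd y1C nz1C E_r.
(* The punctured distance is still at least [delta * n / 2], and #|E| is at most [2 * n * v]. *)
have small2 (X : {set 'I_D}) :
    (#|X| * (min_dist C - k') <= #|E|)%N -> #|X|%:R <= 4 * (v / delta).
  move=> XE; have := leq_trans XE E_le.
  rewrite -(ler_nat R) !natrM natrB ?(ltnW k'd) // dE => le1.
  have le2 : #|X|%:R * (delta * n / 2) <= #|X|%:R * (delta * n - k'%:R).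
    by rewrite ler_wpM2l //; move: (delta * n) pd k'p => *; lra.
  have le3 : #|X|%:R * (delta * n / 2) <= 2 * (n * v).
    apply: le_trans le2 (le_trans le1 _).
    by rewrite ler_wpM2l // ler_wpM2l.
  have h_gt0 : 0 < delta * n / 2 by have := dn_gt0; lra.
  rewrite -(ler_pM2r h_gt0); apply: le_trans le3 _.
  by rewrite le_eqVlt; apply/orP; left; apply/eqP; field; rewrite gt_eqF.
have A2s := small2 _ A2E; have B2s := small2 _ B2E.
have compl_le (X Y : {set 'I_D}) : #|X| = k' -> #|Y|%:R <= 4 * (v / delta) ->
    #|~: (~: X :\: Y)|%:R <= p + 4 * (v / delta).
  move=> Xk Ys; apply: le_trans (lerD k'p Ys).
  by rewrite -Xk -natrD ler_nat setCD setCK leq_card_setU.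
have lt_d (X : {set 'I_D}) : #|X|%:R <= p + 4 * (v / delta) -> (#|X| < min_dist C)%N.
  move=> Xp; rewrite -(ltr_nat R) dE; apply: le_lt_trans Xp _.
  by have := p_small; have := dn_gt0; move: (delta * n) => *; lra.
have Ac := compl_le _ _ A1k A2s; have Bc := compl_le _ _ B1k B2s.
have [i j iA jB|y [yC _ yz1]] := tensor_extension (lt_d _ Ac) (lt_d _ Bc) y1C z1C.
  by have := yz0 i j iA jB; rewrite mxE [X in _ + X]mxE => /subr0_eq.
exists y; split=> //.
(* Rows outside [A] are charged in full; rows in [A] agree with [z1], which is within [m] of [Z x]
   there. *)
have upper : (hweight (Z x - y))%:R <= n * (p + 4 * (v / delta) + v).
  pose A := ~: A1 :\: A2.
  have rowle i : (#|row_supp (Z x - y) i| <= D * (i \in ~: A) + m)%N.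
    rewrite inE; have [iA|iA] := boolP (i \in A); last first.
      by rewrite muln1 -[leqLHS]addn0 leq_add // -[leqRHS](card_ord D) max_card.
    rewrite muln0 add0n; have iA0 : i \notin A0.
      move: iA; rewrite in_setD in_setC => /andP[_].
      by apply: contra; apply: (subsetP A01).
    have [_ /(_ iA0)] := fP i; apply: leq_trans; apply: subset_leq_card.
    apply/subsetP => j; rewrite !inE !mxE yz1 // mxE.
    by rewrite subr_eq0.
  have : (hweight (Z x - y) <= D * #|~: A| + D * m)%N.
    rewrite hweight_sum_rows; apply: (@leq_trans (\sum_i (D * (i \in ~: A) + m))%N).
      by apply: leq_sum => i _; exact: rowle.
    rewrite big_split /= sum_nat_const card_ord -big_distrr /= leq_add2r.
    rewrite leq_mul2l sum_mem_card; apply/orP; right; apply: eq_leq.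
    by apply: eq_card => i; rewrite !inE.
  rewrite -(ler_nat R) natrD !natrM => /le_trans; apply.
  by rewrite -mulrDr ler_wpM2l // lerD.
(* At least [delta ^+ 2 * n / 1024] heavy rows, each of weight at least [delta * n / 2]. *)
have lower : n * (delta ^+ 3 * n / 2048) <= (hweight (Z x))%:R.
  have le1 : (k x * min_dist C <= 2 * hweight (Z x))%N.
    rewrite hweight_sum_rows big_distrr /= (bigID (heavy x)) /=.
    apply: leq_trans (leq_addr _ _).
    rewrite /k -sum1dep_card big_distrl /=; apply: leq_sum => i.
    by rewrite mul1n => /andP[].
  move: le1; rewrite -(ler_nat R) !natrM dE => le1.
  have := ler_wpM2r (ltW dn_gt0) kx => le2.
  rewrite -(ler_pM2l (ltr0n R 2)); apply: le_trans (le_trans le2 le1).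
  by rewrite le_eqVlt; apply/orP; left; apply/eqP; field.
rewrite -(ltr_nat R); apply: le_lt_trans upper (lt_le_trans _ lower).
by rewrite ltr_pM2l ?ltr0n.
Qed.

End RowStep.

(** Every normal vertex has a heavy row or a heavy column, so one kind occurs at half of them or
    more. Columns become rows after transposition, and the tensor codeword found is transposed
    back. *)
Lemma local_improvement (V : finType) (al be : 'I_D -> V -> V)
    (s t : 'I_D -> 'I_D) (Z : V -> 'M['F_2]_D) :
  square_views C al be s t Z ->
  spectral_gap al (4 * n) -> spectral_gap be (4 * n) ->
  8 * n * #|[set x | other_view al s Z x != 0]|%:R <= delta * #|V|%:R ->
  [set x | other_view al s Z x != 0] != set0 ->
  exists x y, in_tensor C C y /\ (hweight (Z x - y) < hweight (Z x))%N.
Proof.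
move=> sv gapA gapB S_small S_neq0.
pose W := other_view al s Z; pose S := [set x | W x != 0].
pose Se := [set x | n * u < (hweight (W x))%:R].
pose N1 := [set x in S :\: Se | [exists i, min_dist C <= 2 * #|row_supp (W x) i|]%N].
pose N2 := [set x in S :\: Se | [exists i, min_dist C <= 2 * #|row_supp (W x)^T i|]%N].
have cover : (#|S :\: Se| <= #|N1| + #|N2|)%N.
  apply: leq_trans (leq_card_setU _ _); apply: subset_leq_card.
  apply/subsetP => x xN; rewrite in_setU ![x \in [set _ in _ | _]]inE xN /=.
  move: xN; rewrite !inE -leNgt => /andP[xSe xS].
  have [_ _ /(_ xS) [[i hi]|[i hi]]] := light_lines xSe (sv_dual sv x).
    by apply/orP; left; apply/existsP; exists i.
  by apply/orP; right; apply/existsP; exists i.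
have [N1_large|N1_small] := leqP #|S :\: Se| (2 * #|N1|).
  exact: row_improvement sv gapA gapB S_small S_neq0 N1_large.
have WT x : other_view be t (fun y => (Z y)^T) x = (W x)^T := other_view_tr x sv.
have ST : [set x | other_view be t (fun y => (Z y)^T) x != 0] = S.
  by apply/setP => x; rewrite !inE WT trmx_eq0.
have SeT : [set x | n * u <
    (hweight (other_view be t (fun y => (Z y)^T) x))%:R] = Se.
  by apply/setP => x; rewrite !inE WT hweight_tr.
have le2 : (#|S :\: Se| <= 2 * #|N2|)%N.
  by move: cover N1_small; move: #|N1| #|N2| #|_| => a b c; clear; lia.
have ND := f_equal2 (fun X Y : {set V} => X :\: Y) ST SeT.
have N2T : [set x in [set x | other_view be t (fun y => (Z y)^T) x != 0] :\:
      [set x | n * u < (hweight (other_view be t (fun y => (Z y)^T) x))%:R] |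
     [exists i, (min_dist C <=
       2 * #|row_supp (other_view be t (fun y => (Z y)^T) x) i|)%N]] = N2.
  apply/setP => x; rewrite [LHS]inE [RHS]inE; congr (_ && _).
    exact: (congr1 (fun X : {set V} => x \in X) ND).
  by apply: eq_existsb => i; rewrite WT.
have [] := row_improvement (square_views_tr sv) gapB gapA.
- rewrite ST; exact: S_small.
- by rewrite ST.
- exact: (etrans (f_equal2 (fun X Y : {set V} => (#|X| <= 2 * #|Y|)%N) ND N2T) le2).
move=> x [y [yC lt_y]]; exists x, y^T; split.
  case/andP: yC => /forallP ycol /forallP yrow.
  apply/andP; split; apply/forallP => i; last by rewrite -tr_col.
  by rewrite tr_col trmxK.
by rewrite -(hweight_tr (Z x)) (leq_ltn_trans _ lt_y) // -hweight_tr linearB /= trmxK.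
Qed.

End LocalImprovement.

(** * Growth rates for large block length *)

Lemma powR_eventually_dominates (R : realType) (a b K : R) :
  a < b -> exists D0 : nat, forall D : nat, (D0 <= D)%N ->
    K * D%:R `^ a <= D%:R `^ b.
Proof.
move=> ab; pose c := b - a; have c_gt0 : 0 < c by rewrite subr_gt0.
pose K1 := 1 + `|K|; have K1_gt0 : 0 < K1 by rewrite ltr_pwDl.
pose x := K1 `^ c^-1; have x_ge0 : 0 <= x by exact: powR_ge0.
exists (Num.truncn x).+1 => D xD.
have xn : x <= D%:R.
  by apply: le_trans (ltW (truncnS_gt x)) _; rewrite ler_nat.
have n_gt0 : (0 : R) < D%:R by rewrite ltr0n (leq_trans _ xD).
have -> : D%:R `^ b = D%:R `^ c * D%:R `^ a.
  rewrite -[in LHS](subrK a b) powRD //.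
  by rewrite (gt_eqF n_gt0) implybT.
rewrite ler_wpM2r ?powR_ge0 //; apply: (@le_trans _ _ K1).
  by rewrite /K1 (le_trans (ler_norm K)) // lerDr.
have -> : K1 = x `^ c by rewrite /x -powRrM mulVf ?gt_eqF // powRr1 ?ltW.
by apply: ge0_ler_powR; rewrite ?nnegrE //; exact: ltW.
Qed.

(** Each inequality compares powers of [n] with strictly ordered exponents: [gamma > 1/2 + eps]
    gives [up], the slack [eps / 2] gives [ur], and [gamma < 1] with [1/2 - eps < 1] gives the last
    one. *)
Lemma distance_regime (R : realType) (eps gamma delta : R) :
  0 < eps -> eps < 1 / 2 -> 1 / 2 + eps < gamma -> gamma < 1 -> 0 < delta ->
  exists D0 : nat, forall D : nat, (D0 <= D)%N ->
  let n : R := D%:R in let u := n `^ (1 / 2 - eps) in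
  let v := u / delta in let p := n `^ gamma in
  [/\ (0 < D)%N, 12 <= u, 1 <= p & 128 * n <= u * p] /\
  2 * n * u <= delta * n `^ (3 / 2 - eps / 2) /\
  p + 4 * (v / delta) + v < delta ^+ 3 * n / 2048.
Proof.
move=> eps_gt0 eps_lt gamma_gt gamma_lt delta_gt0.
have d3_gt0 : 0 < delta ^+ 3 by rewrite exprn_gt0.
have [|D1 H1] := @powR_eventually_dominates R 0 (1 / 2 - eps) 12; first by lra.
have [|D2 H2] := @powR_eventually_dominates R 0 gamma 1; first by lra.
have [|D3 H3] := @powR_eventually_dominates R 1 (1 / 2 - eps + gamma) 128.
  by lra.
have [|D4 H4] := @powR_eventually_dominates R (1 + (1 / 2 - eps))
  (3 / 2 - eps / 2) (2 / delta); first by lra.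
have [|D5 H5] := @powR_eventually_dominates R gamma 1 (8192 / delta ^+ 3); first by lra.
have [|D6 H6] := @powR_eventually_dominates R (1 / 2 - eps) 1
  ((4 / delta ^+ 2 + delta^-1) * (8192 / delta ^+ 3)); first by lra.
exists (1 + D1 + D2 + D3 + D4 + D5 + D6)%N => D D_ge.
have D_gt0 : (0 < D)%N by clear -D_ge; lia.
have n_neq0 : D%:R != 0 :> R by rewrite pnatr_eq0 -lt0n.
have n_ge0 : (0 : R) <= D%:R by rewrite ler0n.
have {}H1 : 12 * D%:R `^ 0 <= _ := H1 D ltac:(clear -D_ge; lia).
have {}H2 : 1 * D%:R `^ 0 <= _ := H2 D ltac:(clear -D_ge; lia).
have {}H3 := H3 D ltac:(clear -D_ge; lia); have {}H4 := H4 D ltac:(clear -D_ge; lia).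
have {}H5 := H5 D ltac:(clear -D_ge; lia); have {}H6 := H6 D ltac:(clear -D_ge; lia).
rewrite powRr0 mulr1 in H1; rewrite powRr0 mulr1 in H2.
rewrite powRr1 // powRD ?n_neq0 ?implybT // in H3.
rewrite powRD ?n_neq0 ?implybT // powRr1 // in H4.
rewrite powRr1 // in H5; rewrite powRr1 // in H6.
move=> n u v p; rewrite -/n -/u -/p in H1 H2 H3 H4 H5 H6.
split; [split => // | split].
- rewrite -(ler_pM2l (_ : 0 < delta^-1)) ?invr_gt0 // mulKf ?gt_eqF //.
  by apply: le_trans H4; rewrite le_eqVlt; apply/orP; left; apply/eqP; ring.
(* The two bounds by 1/8192 add up to 1/4096, strictly below the required 1/2048. *)
have h5 : p <= delta ^+ 3 * n / 8192.
  rewrite -(ler_pM2l (_ : 0 < 8192 / delta ^+ 3)) ?divr_gt0 //.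
  by apply: le_trans H5 _; rewrite le_eqVlt; apply/orP; left; apply/eqP; field;
     rewrite gt_eqF.
have h6 : 4 * (v / delta) + v <= delta ^+ 3 * n / 8192.
  rewrite -(ler_pM2l (_ : 0 < 8192 / delta ^+ 3)) ?divr_gt0 //.
  apply: le_trans (le_trans _ H6) _.
    by rewrite le_eqVlt; apply/orP; left; apply/eqP; rewrite /v; field; rewrite gt_eqF.
  by rewrite le_eqVlt; apply/orP; left; apply/eqP; field; rewrite gt_eqF.
have : 0 < delta ^+ 3 * n by rewrite mulr_gt0 ?ltr0n.
move: h5 h6; move: (v / delta) (delta ^+ 3 * n) => a b; lra.
Qed.

(** * Descent to a codeword *)

Definition mismatch (V : finType) n (al be : 'I_n -> V -> V) (s t : 'I_n -> 'I_n)
    (c : V -> 'M['F_2]_n) (x : V) : 'M['F_2]_n :=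
  \matrix_(i, j) (c x i j + c (al i (be j x)) (s i) (t j)).

Definition nonzero_entries (V : finType) n (Z : V -> 'M['F_2]_n) :
    {set V * ('I_n * 'I_n)} :=
  [set e | Z e.1 e.2.1 e.2.2 != 0].

(** [ct_free] is the form in which TNC enters: the two V_0-vertices of a square are distinct. *)
Record commuting_translations n (V : finType) (al be : 'I_n -> V -> V)
    (s t : 'I_n -> 'I_n) : Prop := CommutingTranslations {
  ct_sK : involutive s;
  ct_tK : involutive t;
  ct_alK : forall i x, al (s i) (al i x) = x;
  ct_beK : forall j x, be (t j) (be j x) = x;
  ct_comm : forall i j x, al i (be j x) = be j (al i x);
  ct_free : forall i j x, al i (be j x) != x }.

Section Descent.

Variables (V : finType) (n : nat) (al be : 'I_n -> V -> V) (s t : 'I_n -> 'I_n).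
Hypothesis ct : commuting_translations al be s t.
Variable C : {vspace 'rV['F_2]_n}.

(** The same square, seen from its other V_0-vertex. *)
Let opp (e : V * ('I_n * 'I_n)) : V * ('I_n * 'I_n) :=
  (al e.2.1 (be e.2.2 e.1), (s e.2.1, t e.2.2)).

Let oppK : involutive opp.
Proof.
case: ct => sK tK alK beK comm _ [x [i j]]; rewrite /opp /= sK tK.
by rewrite -comm beK alK.
Qed.

Lemma mismatch_opp c x i j :
  mismatch al be s t c (al i (be j x)) (s i) (t j) = mismatch al be s t c x i j.
Proof.
case: ct => sK tK alK beK comm _; rewrite !mxE sK tK addrC.
by rewrite -[in be (t j) _]comm beK alK.
Qed.

(** At a V_1-vertex the values proposed from [be j x] fill column [j] with a column of a tensor
    codeword, and those from [al i x] fill row [i] with a row of one. *)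
Lemma mismatch_square_views c :
  (forall x, in_tensor C C (c x)) ->
  square_views C al be s t (mismatch al be s t c).
Proof.
case: (ct) => sK tK alK beK comm _ cC; split=> // [x i j|x].
  exact: mismatch_opp.
exists (\matrix_(i, j) c (be j x) i (t j)), (\matrix_(i, j) c (al i x) (s i) j).
split=> [|j|i].
- by apply/matrixP => i j; rewrite !mxE sK addrC comm alK.
- case/andP: (cC (be j x)) => /forallP /(_ (t j)) cj _.
  by rewrite (_ : _^T = (col (t j) (c (be j x)))^T) //; apply/rowP => i; rewrite !mxE.
- case/andP: (cC (al i x)) => _ /forallP /(_ (s i)) ci.
  by rewrite (_ : row _ _ = row (s i) (c (al i x))) //; apply/rowP => j; rewrite !mxE.
Qed.

(** Entries at [x] and entries whose opposite lies at [x] are exchanged by [opp] and are disjoint by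
    [ct_free]; the rest belong to squares avoiding [x]. *)
Lemma card_nonzero_entries (Z : V -> 'M['F_2]_n) x :
  (forall y i j, Z (al i (be j y)) (s i) (t j) = Z y i j) ->
  #|nonzero_entries Z| = (2 * hweight (Z x) +
    #|[set e in nonzero_entries Z | (e.1 != x) && ((opp e).1 != x)]|)%N.
Proof.
move=> sym; pose P1 := [set e in nonzero_entries Z | e.1 == x].
pose P2 := [set e in nonzero_entries Z | (opp e).1 == x].
have P1E : #|P1| = hweight (Z x).
  rewrite /hweight -[RHS](card_imset _ (f := fun ij => (x, ij))); last by move=> ? ? [].
  apply: eq_card => -[y ij]; rewrite !inE /=; apply/andP/imsetP.
    by case=> Zy /eqP yx; exists ij; rewrite -?yx ?inE.
  by case=> ij' /[!inE] Zij [-> ->].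
have P2E : #|P2| = hweight (Z x).
  rewrite -P1E -[RHS](card_imset _ (can_inj oppK)); apply: eq_card => e.
  rewrite -{2}(oppK e) mem_imset ?inE; last exact: can_inj oppK.
  by rewrite /= sym.
have P12 : [disjoint P1 & P2].
  rewrite disjoint_subset; apply/subsetP => -[y [i j]].
  rewrite !inE /= => /andP[_ /eqP ->].
  by case: ct => _ _ _ _ _ free; rewrite (negPf (free i j x)) andbF.
rewrite mul2n -addnn -{1}P1E -P2E -cardsUI (disjoint_setI0 P12) cards0 addn0.
rewrite -(cardsID (P1 :|: P2) (nonzero_entries Z)); congr (_ + _)%N.
  by apply: eq_card => e; rewrite !inE -andb_orr; case: (_ != 0).
by apply: eq_card => e; rewrite !inE /=;
   case: (Z _ _ _ != 0); case: (e.1 == x); case: (al _ _ == x).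
Qed.

(** Changing [c] at [x] subtracts [y] from the mismatch at [x] and leaves squares avoiding [x]
    alone. *)
Lemma mismatch_update c x (y : 'M['F_2]_n) :
  (hweight (mismatch al be s t c x - y) < hweight (mismatch al be s t c x))%N ->
  (#|nonzero_entries (mismatch al be s t (fun g => if g == x then (c g - y)%R else c g))|
     < #|nonzero_entries (mismatch al be s t c)|)%N.
Proof.
set c' := (fun g => if g == x then _ else _) => lt.
rewrite (card_nonzero_entries x (mismatch_opp c)).
rewrite (card_nonzero_entries x (mismatch_opp c')).
have -> : mismatch al be s t c' x = mismatch al be s t c x - y.
  apply/matrixP => i j; case: ct => _ _ _ _ _ free.
  by rewrite !mxE /c' eqxx (negPf (free i j x)) !mxE addrAC.
set E' := [set e in _ | _]; set E := [set e in nonzero_entries (mismatch _ _ _ _ c) | _].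
have -> : E' = E.
  apply/setP => -[z [i j]]; rewrite !inE /=.
  case: (eqVneq z x) => [|zx]; rewrite ?andbF //=.
  case: (eqVneq (al i (be j z)) x) => [|zx']; rewrite ?andbF //=.
  by rewrite !mxE /c' (negPf zx) (negPf zx').
by lia.
Qed.

Lemma card_other_view_neq0 (Z : V -> 'M['F_2]_n) :
  (#|[set x | other_view al s Z x != 0%R]| <= #|nonzero_entries Z|)%N.
Proof.
case: ct => sK _ alK _ _ _.
apply: leq_trans (leq_imset_card (fun e : V * ('I_n * 'I_n) => al e.2.1 e.1) _).
apply: subset_leq_card; apply/subsetP => x; rewrite inE => /hweight_gt0.
case/card_gt0P => -[i j]; rewrite inE mxE /= => Zij.
by apply/imsetP; exists (al i x, (s i, j)); rewrite ?inE //= alK.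
Qed.

Lemma other_view_neq0 (Z : V -> 'M['F_2]_n) :
  nonzero_entries Z != set0 -> [set x | other_view al s Z x != 0] != set0.
Proof.
case: ct => sK _ alK _ _ _.
case/set0Pn => -[x [i j]]; rewrite inE /= => Zij.
apply/set0Pn; exists (al i x); rewrite inE; apply: contraNneq Zij.
by move=> /matrixP /(_ (s i) j); rewrite !mxE sK alK => ->.
Qed.

(** Each improvement alters [c] at one vertex and lowers the number of non-zero entries, so that
    number bounds the altered vertices. Closing [small] downwards keeps improvement available
    throughout. *)
Lemma descent (small : nat -> Prop) c :
  (forall k l, (k <= l)%N -> small l -> small k) ->
  (forall Z, square_views C al be s t Z -> small #|nonzero_entries Z| ->
     nonzero_entries Z != set0 ->
     exists x y, in_tensor C C y /\ (hweight (Z x - y) < hweight (Z x))%N) ->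
  (forall x, in_tensor C C (c x)) ->
  small #|nonzero_entries (mismatch al be s t c)| ->
  exists c', [/\ forall x, in_tensor C C (c' x), forall x, mismatch al be s t c' x = 0 &
    (#|[set x | c' x != c x]| <= #|nonzero_entries (mismatch al be s t c)|)%N].
Proof.
move=> small_le improve.
have [k] := ubnP #|nonzero_entries (mismatch al be s t c)|.
elim: k c => // k IHk c; rewrite ltnS => ck cC csmall.
have [Z0|Z_neq0] := eqVneq (nonzero_entries (mismatch al be s t c)) set0.
  exists c; split=> // [x|].
    apply/matrixP => i j; apply/eqP; rewrite [_ 0 i j]mxE; apply: contraT => Zij.
    by have := in_set0 (x, (i, j)); rewrite -Z0 inE Zij.
  by rewrite (_ : [set _ | _] = set0) ?cards0 //; apply/setP => x; rewrite !inE eqxx.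
have [x [y [yC lt_y]]] := improve _ (mismatch_square_views cC) csmall Z_neq0.
pose c1 g := if g == x then c g - y else c g.
have lt1 : (#|nonzero_entries (mismatch al be s t c1)| <
            #|nonzero_entries (mismatch al be s t c)|)%N by exact: mismatch_update.
have c1C g : in_tensor C C (c1 g).
  rewrite /c1; case: eqP => // _; case/andP: yC => /forallP ycol /forallP yrow.
  case/andP: (cC g) => /forallP ccol /forallP crow.
  apply/andP; split; apply/forallP => i.
    by rewrite !linearB rpredB ?ycol ?ccol.
  by rewrite linearB rpredB ?yrow ?crow.
have [||c' [c'C Zc' le']] := IHk c1 _ c1C.
- exact: leq_trans lt1 ck.
- exact: small_le (ltnW lt1) csmall.
exists c'; split=> //; apply: leq_trans (leq_ltn_trans le' lt1).
rewrite -[leqRHS]add1n -[X in (_ <= X + _)%N](cards1 x).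
apply: leq_trans (leq_card_setU _ _); apply: subset_leq_card.
apply/subsetP => z; rewrite !inE /c1; case: (eqVneq z x) => //= _.
Qed.

End Descent.

(** * The left-right Cayley complex *)

Lemma memV_symm (gT : finGroupType) (X : {set gT}) x :
  (X^-1 = X)%g -> x \in X -> (x^-1)%g \in X.
Proof. by move=> XV xX; rewrite -XV inE invgK. Qed.

Lemma square_flip (gT : finGroupType) (g a b : gT) :
  square (a * g * b)%g (a^-1)%g (b^-1)%g = square g a b.
Proof.
apply/setP => x; rewrite /square !inE !mulgA mulVg mul1g !mulgK.
by do 4 case: (x == _).
Qed.

Section Square.

Variables (gT : finGroupType) (A B : {set gT}).
Hypothesis tnc : TNC A B.

Lemma square_false (g h a b : gT) :
  ((h, false) \in square g a b) = (h == g) || (h == (a * g * b)%g).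
Proof. by rewrite !inE !xpair_eqE /= !andbT !andbF !orbF. Qed.

Lemma square_true (g h a b : gT) :
  ((h, true) \in square g a b) = (h == (a * g)%g) || (h == (g * b)%g).
Proof. by rewrite !inE !xpair_eqE /= !andbT !andbF !orbF. Qed.

(** The V_1-vertices reveal [a] and [b], since TNC forbids confusing [a * g] with [g * b']. *)
Lemma square_inj (g a b a' b' : gT) :
  a \in A -> b \in B -> a' \in A -> b' \in B ->
  square g a b = square g a' b' -> a = a' /\ b = b'.
Proof.
move=> aA bB a'A b'B sq; split.
  have : (a * g)%g \in [set h | (h, true) \in square g a b].
    by rewrite inE square_true eqxx.
  rewrite sq inE square_true => /orP[/eqP/mulIg //|/eqP agb].
  by have := tnc aA b'B agb.
have : (g * b)%g \in [set h | (h, true) \in square g a b].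
  by rewrite inE square_true eqxx orbT.
rewrite sq inE square_true => /orP[/eqP gba|/eqP/mulgI //].
by have := tnc a'A bB (esym gba).
Qed.

Lemma square_eq (g g' a b a' b' : gT) :
  (A^-1 = A)%g -> (B^-1 = B)%g ->
  a \in A -> b \in B -> a' \in A -> b' \in B ->
  square g a b = square g' a' b' ->
  [/\ g' = g, a' = a & b' = b] \/
  [/\ g' = (a * g * b)%g, a' = (a^-1)%g & b' = (b^-1)%g].
Proof.
move=> AV BV aA bB a'A b'B sq.
have : (g', false) \in square g a b by rewrite sq square_false eqxx.
rewrite square_false => /orP[/eqP g'E|/eqP g'E]; [left|right].
  by subst g'; have [-> ->] := square_inj aA bB a'A b'B sq.
have aA' : (a^-1)%g \in A by apply: memV_symm.
have bB' : (b^-1)%g \in B by apply: memV_symm.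
have sq' : square g' a' b' = square g' (a^-1)%g (b^-1)%g.
  by rewrite -sq g'E square_flip.
by have [-> ->] := square_inj a'A b'B aA' bB' sq'.
Qed.

End Square.

Section Complex.

Variables (gT : finGroupType) (A B : {set gT}) (D : nat).
Hypothesis lr : lr_cayley A B D.
Variables (eA : 'I_D -> {a : gT | a \in A}) (eB : 'I_D -> {b : gT | b \in B}).
Hypotheses (eA_bij : bijective eA) (eB_bij : bijective eB).

Let al (i : 'I_D) (g : gT) : gT := (val (eA i) * g)%g.
Let be (j : 'I_D) (g : gT) : gT := (g * val (eB j))%g.

Lemma index_inverse (X : {set gT}) (e : 'I_D -> {x : gT | x \in X}) :
  (X^-1 = X)%g -> bijective e ->
  exists s : 'I_D -> 'I_D, forall i, val (e (s i)) = (val (e i))^-1%g.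
Proof.
move=> XV [f fK eK].
suff : forall i, exists k, val (e k) = (val (e i))^-1%g.
  by case/fin_all_exists => s sE; exists s.
move=> i; have xV := memV_symm XV (valP (e i)).
by exists (f (exist (fun x => x \in X) _ xV)); rewrite eK.
Qed.

Lemma translations_commute :
  exists s t, [/\ commuting_translations al be s t,
    forall i, val (eA (s i)) = (val (eA i))^-1%g &
    forall j, val (eB (t j)) = (val (eB j))^-1%g].
Proof.
case: lr => AV BV _ _ tnc.
have [s sE] := index_inverse AV eA_bij; have [t tE] := index_inverse BV eB_bij.
exists s, t; split=> //; split.
- by move=> i; apply: (bij_inj eA_bij); apply: val_inj; rewrite !sE invgK.
- by move=> i; apply: (bij_inj eB_bij); apply: val_inj; rewrite !tE invgK.
- by move=> i x; rewrite /al sE mulKg.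
- by move=> j x; rewrite /be tE mulgK.
- by move=> i j x; rewrite /al /be mulgA.
move=> i j x; apply/eqP => xE; have := tnc (val (eA i)) (val (eB (t j))) x.
apply; [exact: valP | exact: valP |].
by rewrite tE -[in RHS]xE /al /be mulgA mulgK.
Qed.

Lemma cayley_left_gap (R : realType) : (0 < D)%N ->
  ramanujan R (cayley_left A) D -> spectral_gap al (4 * D%:R : R).
Proof.
case: lr => AV _ _ _ _; have [f fK eK] := eA_bij => D_gt0 ram.
apply: ramanujan_gap ram => // [x y|x y|x i j /mulIg /val_inj /(bij_inj eA_bij) //].
  apply/existsP/existsP => [[a /andP[aA /eqP->]]|[i /eqP->]].
    by exists (f (exist (fun x => x \in A) a aA)); rewrite /al eK.
  by exists (val (eA i)); rewrite (valP (eA i)) eqxx.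
apply/existsP/existsP => -[a /andP[aA /eqP->]]; exists (a^-1)%g;
  by rewrite mulKg eqxx andbT memV_symm.
Qed.

Lemma cayley_right_gap (R : realType) : (0 < D)%N ->
  ramanujan R (cayley_right B) D -> spectral_gap be (4 * D%:R : R).
Proof.
case: lr => _ BV _ _ _; have [f fK eK] := eB_bij => D_gt0 ram.
apply: ramanujan_gap ram => // [x y|x y|x i j /mulgI /val_inj /(bij_inj eB_bij) //].
  apply/existsP/existsP => [[b /andP[bB /eqP->]]|[i /eqP->]].
    by exists (f (exist (fun x => x \in B) b bB)); rewrite /be eK.
  by exists (val (eB i)); rewrite (valP (eB i)) eqxx.
apply/existsP/existsP => -[b /andP[bB /eqP->]]; exists (b^-1)%g;
  by rewrite mulgK eqxx andbT memV_symm.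
Qed.

Let sq (g : gT) (i j : 'I_D) : lrsquare A B := incident_square g (eA i) (eB j).

Lemma squares_atE g :
  squares_at A B (g, false) = [set sq g ij.1 ij.2 | ij in [set: 'I_D * 'I_D]].
Proof.
case: lr => AV BV _ _ tnc; have [f fK eK] := eA_bij; have [f' fK' eK'] := eB_bij.
have mem a b (aA : a \in A) (bB : b \in B) (q : lrsquare A B) :
    val q = square g a b -> q \in [set sq g ij.1 ij.2 | ij in [set: 'I_D * 'I_D]].
  move=> qE; apply/imsetP.
  exists (f (exist (fun x => x \in A) a aA),
          f' (exist (fun x => x \in B) b bB)) => //.
  by apply: val_inj; rewrite /= eK eK'.
apply/setP => q; apply/idP/idP => [|/imsetP[[i j] _ ->]]; last first.
  by rewrite inE /= square_false eqxx.
rewrite inE; have := valP q; rewrite inE => /existsP[g0 /existsP[a /andP[aA]]].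
move=> /existsP[b /andP[bB /eqP qE]]; rewrite qE square_false => /orP[/eqP gE|/eqP gE].
  by apply: (mem a b); rewrite // gE.
have aA' : (a^-1)%g \in A by apply: memV_symm.
have bB' : (b^-1)%g \in B by apply: memV_symm.
by apply: (mem _ _ aA' bB'); rewrite qE gE square_flip.
Qed.

Lemma card_squares_at g : #|squares_at A B (g, false)| = (D ^ 2)%N.
Proof.
case: lr => _ _ _ _ tnc.
rewrite squares_atE card_imset ?cardsT ?card_prod ?card_ord ?mulnn //.
move=> [i j] [i' j'] /(congr1 val) /= sqE.
have [] := square_inj tnc (valP (eA i)) (valP (eB j)) (valP (eA i'))
             (valP (eB j')) sqE.
by move=> /val_inj /(bij_inj eA_bij) -> /val_inj /(bij_inj eB_bij) ->.
Qed.

(** Double counting of incidences: a V_0-vertex lies on [D ^ 2] squares, a square has at most two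
    V_0-vertices. *)
Lemma card_squares_ge : (#|gT| * D ^ 2 <= 2 * #|{: lrsquare A B}|)%N.
Proof.
have -> : (#|gT| * D ^ 2 = \sum_(g : gT) #|squares_at A B (g, false)|)%N.
  rewrite -sum_nat_const; apply: eq_bigr => g _; by rewrite card_squares_at.
under eq_bigr => g _ do rewrite -sum1dep_card.
rewrite (exchange_big_dep xpredT) //= mulnC -sum_nat_const; apply: leq_sum => q _.
rewrite sum1dep_card; have := valP q; rewrite inE.
move=> /existsP[g0 /existsP[a /andP[aA /existsP[b /andP[bB /eqP qE]]]]].
apply: leq_trans (_ : #|[set g0; (a * g0 * b)%g]| <= _)%N; last first.
  by rewrite cards2; case: eqP.
by apply: subset_leq_card; apply/subsetP => g; rewrite inE qE square_false !inE.
Qed.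

Lemma local_view_ext (x y : {ffun lrsquare A B -> 'F_2}) g :
  {in squares_at A B (g, false), x =1 y} -> local_view eA eB x g = local_view eA eB y g.
Proof.
move=> xy; apply/matrixP => i j; rewrite !mxE; apply: xy.
by rewrite squares_atE; apply/imsetP; exists (i, j).
Qed.

End Complex.

(** * Soundness of the tester *)

Lemma F2_add_eq0 (x y : 'F_2) : (x + y == 0) = (x == y).
Proof. by rewrite -{1}(oppr_pchar2 (pchar_Fp (isT : prime 2)) y) subr_eq0. Qed.

Section Soundness.

Variables (gT : finGroupType) (A B : {set gT}) (D : nat).
Hypothesis lr : lr_cayley A B D.
Variables (eA : 'I_D -> {a : gT | a \in A}) (eB : 'I_D -> {b : gT | b \in B}).
Hypotheses (eA_bij : bijective eA) (eB_bij : bijective eB).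
Variables (C : {vspace 'rV['F_2]_D}) (s t : 'I_D -> 'I_D).

Let al (i : 'I_D) (g : gT) : gT := (val (eA i) * g)%g.
Let be (j : 'I_D) (g : gT) : gT := (g * val (eB j))%g.

Hypothesis ct : commuting_translations al be s t.
Hypothesis sE : forall i, val (eA (s i)) = (val (eA i))^-1%g.
Hypothesis tE : forall j, val (eB (t j)) = (val (eB j))^-1%g.

Let sq (g : gT) (i j : 'I_D) : lrsquare A B := incident_square g (eA i) (eB j).

Lemma incident_square_flip g i j : sq (al i (be j g)) (s i) (t j) = sq g i j.
Proof. by apply: val_inj; rewrite /= sE tE /al /be mulgA square_flip. Qed.

Lemma incident_square_eq g i j g' i' j' : sq g i j = sq g' i' j' ->
  [/\ g' = g, i' = i & j' = j] \/ [/\ g' = al i (be j g), i' = s i & j' = t j].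
Proof.
case: lr => AV BV _ _ tnc /(congr1 val) /= sqE.
have [[-> ei ej]|[-> ei ej]] := square_eq tnc AV BV (valP (eA i)) (valP (eB j))
  (valP (eA i')) (valP (eB j')) sqE; [left|right]; split=> //.
- by apply: (bij_inj eA_bij); apply: val_inj.
- by apply: (bij_inj eB_bij); apply: val_inj.
- by rewrite /al /be mulgA.
- by apply: (bij_inj eA_bij); apply: val_inj; rewrite sE.
- by apply: (bij_inj eB_bij); apply: val_inj; rewrite tE.
Qed.

Lemma incident_square_surj (q : lrsquare A B) : exists g i j, q = sq g i j.
Proof.
have [f fK eK] := eA_bij; have [f' fK' eK'] := eB_bij.
have := valP q; rewrite inE => /existsP[g /existsP[a /andP[aA]]].
move=> /existsP[b /andP[bB /eqP qE]]; exists g.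
exists (f (exist (fun x => x \in A) a aA)), (f' (exist (fun x => x \in B) b bB)).
by apply: val_inj; rewrite /= eK eK'.
Qed.

(** Zero mismatch says that both V_0-vertices of a square propose the same value, so any
    representation found by [pick] defines the word consistently. *)
Lemma glue_local_views (c : gT -> 'M['F_2]_D) :
  (forall g, mismatch al be s t c g = 0) ->
  exists w : {ffun lrsquare A B -> 'F_2}, forall g, local_view eA eB w g = c g.
Proof.
move=> c0; have cE g i j : c (al i (be j g)) (s i) (t j) = c g i j.
  have /matrixP /(_ i j) := c0 g; rewrite !mxE => /eqP.
  by rewrite F2_add_eq0 => /eqP.
pose w : {ffun lrsquare A B -> 'F_2} := [ffun q =>
  if [pick e : gT * ('I_D * 'I_D) | q == sq e.1 e.2.1 e.2.2] is Some e
  then c e.1 e.2.1 e.2.2 else 0].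
exists w => g; apply/matrixP => i j; rewrite mxE ffunE -/(sq g i j).
case: pickP => [[g' [i' j']] /eqP /= sqE|none].
  by have [[-> -> ->]|[-> -> ->]] := incident_square_eq sqE.
by have := none (g, (i, j)); rewrite eqxx.
Qed.

Lemma mismatch_local_view (x : {ffun lrsquare A B -> 'F_2}) g i j :
  local_view eA eB x (al i (be j g)) (s i) (t j) = local_view eA eB x g i j.
Proof. by rewrite !mxE -!/(sq _ _ _) incident_square_flip. Qed.

Let rejecting (x : {ffun lrsquare A B -> 'F_2}) : {set gT} :=
  [set g | ~~ in_tensor C C (local_view eA eB x g)].

Let accepted (x : {ffun lrsquare A B -> 'F_2}) (g : gT) : 'M['F_2]_D :=
  if g \in rejecting x then 0 else local_view eA eB x g.

Let accepted_tensor x g : in_tensor C C (accepted x g).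
Proof.
rewrite /accepted inE; case: ifPn => [_|]; last by rewrite negbK.
by apply/andP; split; apply/forallP => i; rewrite linear0 ?linear0 mem0v.
Qed.

(** Two accepting vertices read the same bit of [x], so a mismatched square has a rejecting
    V_0-vertex; the factor 2 counts the square from both ends. *)
Lemma card_mismatch_le x :
  (#|nonzero_entries (mismatch al be s t (accepted x))|
     <= 2 * (#|rejecting x| * D ^ 2))%N.
Proof.
pose E1 := setX (rejecting x) [set: 'I_D * 'I_D].
have E1E : #|E1| = (#|rejecting x| * D ^ 2)%N.
  by rewrite cardsX cardsT card_prod card_ord mulnn.
pose opp (e : gT * ('I_D * 'I_D)) := (al e.2.1 (be e.2.2 e.1), (s e.2.1, t e.2.2)).
rewrite mul2n -addnn -E1E; apply: leq_trans (leq_add (leqnn _) (leq_imset_card opp _)).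
apply: leq_trans (leq_card_setU _ _); apply: subset_leq_card.
apply/subsetP => -[g [i j]]; rewrite inE mxE /= => neq0.
rewrite in_setU !in_setX in_setT andbT; case: (boolP (g \in _)) => //= g_ok.
case: (boolP (al i (be j g) \in rejecting x)) => [rej|g'_ok].
  apply/imsetP; exists (al i (be j g), (s i, t j)); first by rewrite in_setX rej in_setT.
  by case: ct => sK tK alK beK comm _; rewrite /opp /= sK tK -comm beK alK.
move: neq0; rewrite /accepted (negPf g_ok) (negPf g'_ok) mismatch_local_view.
by rewrite F2_add_eq0 eqxx.
Qed.

Lemma rejection_lower_bound (small : nat -> Prop) x :
  (forall k l, (k <= l)%N -> small l -> small k) ->
  (forall Z, square_views C al be s t Z -> small #|nonzero_entries Z| ->
     nonzero_entries Z != set0 ->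
     exists x y, in_tensor C C y /\ (hweight (Z x - y) < hweight (Z x))%N) ->
  small (2 * (#|rejecting x| * D ^ 2))%N ->
  (hdist_code x (tanner_code eA eB C)
     <= #|rejecting x| * (1 + 2 * D ^ 2) * D ^ 2)%N.
Proof.
move=> small_le improve x_small.
have [c [cC c0 c_le]] := descent ct small_le improve (accepted_tensor x)
  (small_le _ _ (card_mismatch_le x) x_small).
have [w wc] := glue_local_views c0.
have w_code : w \in tanner_code eA eB C.
  by rewrite inE; apply/forallP => g; rewrite wc.
apply: (@leq_trans (hdist x w)).
  by rewrite -leEnat; apply: bigmin_le_cond.
(* At a vertex that neither rejects nor is altered by the descent, [w] and [x] have the same view,
   so all disagreements lie on squares at [bad] vertices. *)
pose bad := rejecting x :|: [set g | c g != accepted x g].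
have bad_le : (#|bad| <= #|rejecting x| * (1 + 2 * D ^ 2))%N.
  apply: leq_trans (leq_card_setU _ _) _; rewrite mulnDr muln1 leq_add2l.
  by rewrite mulnCA; apply: leq_trans c_le (card_mismatch_le x).
apply: (@leq_trans #|setX bad [set: 'I_D * 'I_D]|); last first.
  by rewrite cardsX cardsT card_prod card_ord mulnn leq_mul2r bad_le orbT.
apply: leq_trans (leq_imset_card
  (fun e : gT * ('I_D * 'I_D) => sq e.1 e.2.1 e.2.2) _).
apply: subset_leq_card; apply/subsetP => q; rewrite inE => xw.
have [g [i [j qE]]] := incident_square_surj q.
apply/imsetP; exists (g, (i, j)) => //; rewrite in_setX in_setT andbT.
apply: contraNT xw; rewrite in_setU negb_or => /andP[g_ok]; rewrite inE negbK => /eqP cg.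
have /matrixP /(_ i j) : local_view eA eB w g = local_view eA eB x g.
  by rewrite wc cg /accepted (negPf g_ok).
by rewrite !mxE -/(sq g i j) -qE => ->.
Qed.

End Soundness.

Theorem mainTheorem3 (R : realType) (eps gamma delta rho : R)
    (eps_gt0 : 0 < eps) (eps_lt : eps < 1 / 2)
    (gamma_gt : 1 / 2 + eps < gamma) (gamma_lt1 : gamma < 1)
    (delta_gt0 : 0 < delta) (rho_gt0 : 0 < rho) (rho_lt1 : rho < 1) :
  exists Delta0 : nat, forall Delta : nat, (Delta0 <= Delta)%N ->
  forall C : {vspace 'rV['F_2]_Delta},
    (\dim C)%:R = rho * Delta%:R ->
    (min_dist C)%:R = delta * Delta%:R ->
    robust_resistant C C (Delta%:R `^ (3 / 2 - eps / 2)) (Delta%:R `^ gamma) ->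
  exists2 a : R, 0 < a &
  forall (gT : finGroupType) (A B : {set gT}),
    lr_cayley A B Delta ->
    ramanujan R (cayley_left A) Delta ->
    ramanujan R (cayley_right B) Delta ->
  forall (eA : 'I_Delta -> {a : gT | a \in A})
         (eB : 'I_Delta -> {b : gT | b \in B}),
    bijective eA -> bijective eB ->
    local_tester (tanner_code eA eB C)
      (fun g : gT => squares_at A B (g, false))
      (fun (g : gT) x => in_tensor C C (local_view eA eB x g))
      (Delta ^ 2)%N
      (Num.min (a / (a + 1)) (delta / (8 * Delta%:R `^ (3 / 2 + eps)))).
Proof.
have [D0 regime] :=
  distance_regime eps_gt0 eps_lt gamma_gt gamma_lt1 delta_gt0.
exists D0 => D /regime /= [[D_gt0 u_ge12 p_ge1 up] [ur v_small]] C _ dE rob.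
pose n : R := D%:R; have n_gt0 : 0 < n by rewrite ltr0n.
(* 1/K1 serves when the mismatch is small, 1/K2 when it is large. *)
pose K1 := 2 * (1 + 2 * n ^+ 2); pose K2 := 16 * n ^+ 3 / delta.
have K1_gt0 : 0 < K1.
  by rewrite mulr_gt0 // ltr_pwDl // mulr_ge0 // exprn_ge0 // ltW.
have K2_gt0 : 0 < K2 by rewrite divr_gt0 // mulr_gt0 // exprn_gt0.
(* [min_dist C] is at most [D + 1], even with its default value, hence at most [2 * D]. *)
have delta_le2 : delta <= 2.
  rewrite -(ler_pM2r n_gt0) -dE -natrM ler_nat.
  by apply: leq_trans (min_dist_leS C) _; clear -D_gt0; lia.
pose a := Num.min K1^-1 K2^-1.
have a_gt0 : 0 < a by rewrite lt_min !invr_gt0 K1_gt0.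
exists a => // gT A B lr ramA ramB eA eB eA_bij eB_bij.
have [s [t [ct sE tE]]] := translations_commute lr eA_bij eB_bij.
have gapA := cayley_left_gap lr eA_bij D_gt0 ramA.
have gapB := cayley_right_gap lr eB_bij D_gt0 ramB.
split=> [g|g x y xy|x|x].
- exact: (card_squares_at lr eA_bij eB_bij).
- by rewrite (local_view_ext lr eA_bij eB_bij xy).
- by rewrite inE => /forallP.
set rej := [set g : gT | ~~ in_tensor C C (local_view eA eB x g)].
set kappa := Num.min _ _; set dist := hdist_code _ _.
set N := #|{: lrsquare A B}|.
have V_gt0 : (0 : R) < #|gT|%:R by rewrite ltr0n; apply/card_gt0P; exists 1%g.
have card_Q : #|gT|%:R * n ^+ 2 <= 2 * N%:R :> R.
  by rewrite -natrX -!natrM ler_nat; apply: (card_squares_ge lr eA_bij eB_bij).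
have N_gt0 : (0 : R) < N%:R.
  have : 0 < #|gT|%:R * n ^+ 2 by rewrite mulr_gt0 ?exprn_gt0.
  by move: card_Q; move: (_ * _) => q; lra.
have dist_ge0 : (0 : R) <= dist%:R by rewrite ler0n.
have kappa_a : kappa <= a.
  apply: (@le_trans _ _ (a / (a + 1))); first by rewrite /kappa ge_min lexx.
  rewrite ler_pdivrMr ?addr_gt0 // -[leLHS]mulr1 ler_wpM2l ?ltW //.
  by rewrite ltrDr.
have kappa_K1 : kappa <= K1^-1.
  by apply: le_trans kappa_a _; rewrite /a ge_min lexx.
have kappa_K2 : kappa <= K2^-1.
  by apply: le_trans kappa_a _; rewrite /a ge_min lexx orbT.
have rejE : rejection_prob R
    (fun g y => in_tensor C C (local_view eA eB y g)) x = #|rej|%:R / #|gT|%:R.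
  by [].
rewrite rejE mul1r mulrAC ler_pdivrMr //.
(* The first case is converted by the count of squares [card_Q]; in the second the trivial bound of
   the distance by the length suffices. *)
suff [h|h] : dist%:R <= #|rej|%:R * (1 + 2 * n ^+ 2) * n ^+ 2 \/
    delta * #|gT|%:R <= 16 * n ^+ 3 * #|rej|%:R.
- apply: le_trans (ler_wpM2r dist_ge0 kappa_K1) _.
  rewrite ler_pdivrMl //; apply: le_trans h _.
  rewrite (_ : K1 * _ = #|rej|%:R * (1 + 2 * n ^+ 2) * (2 * N%:R / #|gT|%:R));
    last by rewrite /K1; ring.
  apply: ler_wpM2l; last by rewrite ler_pdivlMr // mulrC.
  by rewrite mulr_ge0 // addr_ge0 // mulr_ge0 // exprn_ge0 // ltW.
- apply: le_trans (ler_wpM2r dist_ge0 kappa_K2) _.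
  have distN : dist%:R <= N%:R :> R.
    by rewrite ler_nat /dist -leEnat; apply: bigmin_le_id.
  apply: le_trans (ler_wpM2l _ distN) _; first by rewrite invr_ge0 ltW.
  rewrite ler_wpM2r // invf_div ler_pdivrMr ?mulr_gt0 ?exprn_gt0 //.
  by rewrite mulrAC ler_pdivlMr // [leRHS]mulrC.
pose small (k : nat) : Prop := 8 * n * k%:R <= delta * #|gT|%:R.
have small_le k l : (k <= l)%N -> small l -> small k.
  move=> kl; apply: le_trans; rewrite ler_wpM2l ?ler_nat //.
  by rewrite mulr_ge0 // ltW.
(* The split is on the bound of the mismatch by the number of rejecting vertices; if it is not
   small, rejection is already frequent. *)
have [sm|/ltW lg] := leP (8 * n * (2 * (#|rej| * D ^ 2))%N%:R) (delta * #|gT|%:R).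
  left; rewrite -natrX -[2 * _]natrM nat1r -!natrM ler_nat.
  apply: (rejection_lower_bound lr eA_bij eB_bij ct sE tE small_le _ sm).
  move=> Z sv Z_small Z_neq0.
  have uE := esym (divfK (lt0r_neq0 delta_gt0) (n `^ (1 / 2 - eps))).
  apply: (local_improvement D_gt0 delta_gt0 delta_le2 dE uE u_ge12 p_ge1 up ur
    v_small rob sv gapA gapB).
    exact: small_le (card_other_view_neq0 ct Z) Z_small.
  exact: (other_view_neq0 ct Z_neq0).
right; apply: le_trans lg _; rewrite !natrM ?natrX -/n.
by rewrite le_eqVlt; apply/orP; left; apply/eqP; ring.
Qed.
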